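(* Let $\nu\in\mathcal P_2(\mathbb R)$ with $L_{\rm low}(Q_\nu)>0$ (in particular, $R_\nu$ is Lipschitz continuous). Consider any initial value $g_0=Q_{\mu_0}\in\mathcal C(0,1)$, where $L_{\rm low}(g_0)=0$ is explicitly allowed. Then the strong solution $g\colon[0,\infty)\to\mathcal C(0,1)$ of the Cauchy problem $\partial_t g(t)\in-\partial F_\nu(g(t))$, $t\in(0,\infty)$, $g(0)=Q_{\mu_0}$, satisfies for all $t>0$ $$L_{\rm low}(g(t)) \ge L_{\rm low}(g_0)\cdot e^{-\frac{2t}{L_{\rm low}(Q_\nu)}} + L_{\rm low}(Q_\nu)\cdot\Big(1-e^{-\frac{2t}{L_{\rm low}(Q_\nu)}}\Big)>0.$$ In particular, the cumulative distribution function $R_{\gamma_t}$ of the associated Wasserstein gradient flow $\gamma_t:=(g(t))_\#\Lambda_{(0,1)}$ is Lipschitz continuous for any $t>0$ with Lipschitz constant $$\mathrm{Lip}(R_{\gamma_t}) \le \Big( L_{\rm low}(g_0)\cdot e^{-\frac{2t}{L_{\rm low}(Q_\nu)}} + L_{\rm low}(Q_\nu)\cdot\Big(1-e^{-\frac{2t}{L_{\rm low}(Q_\nu)}}\Big)\Big)^{-1}<\infty.$$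
   Context: $\mathcal P_2(\mathbb R)$ is the set of Borel probability measures on $\mathbb R$ with finite second moment; $\Lambda_{(0,1)}$ is Lebesgue measure on $(0,1)$ and $T_\#\mu=\mu\circ T^{-1}$. For a probability measure $\mu$ on $\mathbb R$: $R_\mu^+(x) := \mu((-\infty,x])$ (written $R_\mu$ if continuous) and $Q_\mu(s) := \min\{x \in \mathbb R : R_\mu^+(x) \ge s\}$, $s\in(0,1)$. $\mathcal C(0,1) := \{ f \in L_2(0,1) : f \text{ is non-decreasing (a.e.)}\}$ is the set of (classes of) quantile functions of measures in $\mathcal P_2(\mathbb R)$; each element is identified with its unique left-continuous non-decreasing representative. The largest lower Lipschitz constant of $Q_\mu\in\mathcal C(0,1)$ is $$L_{\rm low}(Q_\mu) := \max\Big\{L\ge0 : \frac{Q_\mu(s_1)-Q_\mu(s_2)}{s_1-s_2}\ge L \text{ for all } s_1\ne s_2\in(0,1)\Big\}\ge0.$$ $F_\nu\colon L_2(0,1)\to\mathbb R$, $F_\nu(u) = \int_0^1 \big( (1-2s)\,u(s) + \int_0^1 |u(s)-Q_\nu(t)|\,dt \big) ds$, with subdifferential $\partial F(u) := \{ v \in L_2(0,1) : F(w) \ge F(u) + \langle v, w-u\rangle + o(\|w-u\|) \text{ for all } w \}$ (for convex $F$ the $o$-term can be omitted). A strong solution of the Cauchy problem is a function $g \in W^1_1((0,T];L_2(0,1)) \cap C([0,\infty);L_2(0,1))$ for every $T>0$, satisfying the initial condition and, for a.e. $t>0$, the inclusion, with $\partial_t g(t)$ the strong derivative; it exists, is unique,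 and takes values in $\mathcal C(0,1)$. *)

(* Defs.v *)
From HB Require Import structures.
From mathcomp Require Import all_boot all_order all_algebra.
From mathcomp Require Import all_classical all_reals all_analysis.

Set Implicit Arguments.
Unset Strict Implicit.
Unset Printing Implicit Defensive.

Import Order.TTheory GRing.Theory Num.Theory.
Import numFieldNormedType.Exports.

Local Open Scope classical_set_scope.
Local Open Scope ring_scope.

Section quantiles.
Context {R : realType}.
Implicit Types (mu : set (measurableTypeR R) -> \bar R) (Q : R -> R).

Definition finite_second_moment (mu : probability (measurableTypeR R) R) :=
  (\int[mu]_x (x ^+ 2)%:E < +oo)%E.

Definition Rplus mu (x : R) : R := fine (mu [set` `]-oo, x]]).

(* For a probability measure and 0 < s < 1 the infimum is attained, because
   [Rplus mu] is right-continuous. *)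
Definition quantile mu (s : R) : R := inf [set x | s <= Rplus mu x].

Definition lower_lipschitz_constants Q : set R :=
  [set L | 0 <= L /\ forall s1 s2, s1 \in `]0, 1[ -> s2 \in `]0, 1[ ->
     s1 != s2 -> L <= (Q s1 - Q s2) / (s1 - s2)].

(* For [Q] nondecreasing on ]0, 1[ the supremum is a maximum:
   see [Llow_max]. *)
Definition Llow Q : R := sup (lower_lipschitz_constants Q).

Lemma Llow_max Q : {in `]0, 1[ &, {homo Q : x y / x <= y}} ->
  lower_lipschitz_constants Q (Llow Q) /\
  (forall L, lower_lipschitz_constants Q L -> L <= Llow Q).
Proof.
move=> ndQ; set A := lower_lipschitz_constants Q.
have A0 : A 0.
  split=> // s1 s2 s1I s2I; rewrite neq_lt => /orP[] s12.
    rewrite -mulrNN -invrN !opprB divr_ge0 ?subr_ge0 ?(ltW s12)//.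
    by apply: ndQ => //; exact: ltW.
  by rewrite divr_ge0 ?subr_ge0 ?(ltW s12)//; apply: ndQ => //; exact: ltW.
have in3 : (3^-1 : R) \in `]0, 1[.
  by rewrite in_itv/= invr_gt0 invf_lt1 ?ltr0n// ltr1n.
have in2 : (2^-1 : R) \in `]0, 1[.
  by rewrite in_itv/= invr_gt0 invf_lt1 ?ltr0n// ltr1n.
have ne23 : (2^-1 : R) != 3^-1 by rewrite (inj_eq invr_inj) eqr_nat.
have supA : has_sup A.
  split; first by exists 0.
  exists ((Q 2^-1 - Q 3^-1) / (2^-1 - 3^-1)) => L [_ hL].
  exact: hL.
split; last by move=> L AL; exact: (ub_le_sup supA.2).
split; first exact: (ub_le_sup supA.2).
move=> s1 s2 s1I s2I s12; apply: ge_sup; first by exists 0.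
by move=> L [_]; exact.
Qed.

(* The smallest Lipschitz constant; +oo if there is none. *)
Definition Lip (f : R -> R) : \bar R :=
  ereal_sup [set (`|f z.1 - f z.2| / `|z.1 - z.2|)%:E
            | z in [set z : R * R | z.1 != z.2]].

End quantiles.

Section L2.
Context {R : realType}.

Definition Lambda01 : {measure set (measurableTypeR R) -> \bar R} :=
  mrestr (@lebesgue_measure R) (measurable_itv `]0, 1[).

(* Elements of L_2(0,1) are represented by square-integrable functions, so
   that the library's vector space structure on them is available. Two
   functions stand for the same element when they agree a.e., that is when
   the [norm2] of their difference is 0; all notions below are invariant under
   this identification. *)
Definition L2 := LfunType Lambda01 (@lee1n R 2).

Definition norm2 (u : L2) : R := fine ('N[Lambda01]_2%:E[EFin \o u])%E.

Definition inner2 (u v : L2) : R := \int[Lambda01]_s (u s * v s).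

Definition left_continuous_repr (u : L2) (q : R -> R) :=
  [/\ {in `]0, 1[ &, {homo q : x y / x <= y}},
      {in `]0, 1[, forall s, q x @[x --> s^'-] --> q s} &
      {ae Lambda01, forall s, u s = q s}].

Definition C01 : set L2 := [set u | exists q : R -> R,
  {in `]0, 1[ &, {homo q : x y / x <= y}} /\
  {ae Lambda01, forall s, u s = q s}].

(* Every [u] in [C01] has a left-continuous nondecreasing representative, and
   it is unique on ]0, 1[; its values elsewhere never matter. *)
Definition lcrepr (u : L2) : R -> R :=
  xget (cst 0) [set q | left_continuous_repr u q].

Definition Ffun (nu : probability (measurableTypeR R) R) (u : L2) : R :=
  \int[Lambda01]_s ((1 - 2 * s) * u s +
                    \int[Lambda01]_t `|u s - quantile nu t|).

Definition subdifferential (F : L2 -> R) (u : L2) : set L2 :=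
  [set v | forall eps : R, 0 < eps -> exists2 delta : R, 0 < delta &
    forall w : L2, norm2 (w - u) < delta ->
      F w >= F u + inner2 v (w - u) - eps * norm2 (w - u)].

End L2.
Arguments L2 R : clear implicits.

Section bochner.
Context {R : realType}.
Implicit Types (D : set (measurableTypeR R)) (f g h : R -> L2 R).
Notation leb := (@lebesgue_measure R).

Definition step_fun n (A : 'I_n -> set R) (v : 'I_n -> L2 R) (t : R) : L2 R :=
  \sum_i (\1_(A i) t : R) *: v i.

Definition step_integral n (A : 'I_n -> set (measurableTypeR R))
    (v : 'I_n -> L2 R) : L2 R :=
  \sum_i fine (leb (A i)) *: v i.

(* [I] is the Bochner integral of [f] over [D]. *)
Definition bochner_integral D f (I : L2 R) :=
  exists (n : nat -> nat) (A : forall k, 'I_(n k) -> set (measurableTypeR R))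
         (v : forall k, 'I_(n k) -> L2 R),
  [/\ forall k i, [/\ measurable (A k i), A k i `<=` D & (leb (A k i) < +oo)%E],
      forall k,
        measurable_fun D (fun t => norm2 (f t - step_fun (A k) (v k) t)),
      (\int[leb]_(t in D) (norm2 (f t - step_fun (A k) (v k) t))%:E)%E
        @[k --> \oo] --> 0%E &
      norm2 (step_integral (A k) (v k) - I) @[k --> \oo] --> (0 : R)].

Definition bochner_integrable D f := exists I, bochner_integral D f I.

Definition test_function (T : R) (phi : R -> R) :=
  [/\ forall t, derivable phi t 1, continuous (derive1 phi) &
      exists a b, [/\ 0 < a, a <= b, b < T &
                      forall t, t \notin `[a, b] -> phi t = 0]].

Definition weak_derivative (T : R) g h := forall phi, test_function T phi ->
  exists I, bochner_integral `]0, T[ (fun t => derive1 phi t *: g t) I /\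
            bochner_integral `]0, T[ (fun t => phi t *: h t) (- I).

(* The space W^1_1((0,T]; L_2(0,1)): the weak derivative is integrable away
   from 0, and only there. *)
Definition W11 (T : R) g :=
  bochner_integrable `]0, T[ g /\
  exists2 h, weak_derivative T g h &
    forall delta, 0 < delta < T -> bochner_integrable `]delta, T[ h.

Definition continuous_on_nonneg g := forall t, 0 <= t ->
  norm2 (g r - g t) @[r --> within [set` `[0, +oo[] (nbhs t)] --> (0 : R).

Definition strong_derivative g (t : R) (d : L2 R) :=
  norm2 ((r - t)^-1 *: (g r - g t) - d) @[r --> t^'] --> (0 : R).

(* [g] is only meaningful on [0, +oo[; the initial value is given by a
   function on ]0, 1[. *)
Definition strong_solution (F : L2 R -> R) (g0 : R -> R) g :=
  [/\ forall T, 0 < T -> W11 T g,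
      continuous_on_nonneg g,
      {ae Lambda01, forall s, g 0 s = g0 s} &
      {ae leb, forall t, 0 < t -> exists2 d, strong_derivative g t d &
                                    subdifferential F (g t) (- d)}].

End bochner.

(* Main.v *)
From HB Require Import structures.
Require Import Defs.
From mathcomp Require Import all_boot all_order all_algebra.
From mathcomp Require Import all_classical all_reals all_analysis.
From mathcomp Require Import measurable_realfun.
From mathcomp Require Import ring lra.

(** Since [Q_nu] increases at least at speed [L := Llow Q_nu], the distribution
    function [R_nu] is Lipschitz with constant [1 / L]. Hence the energy is
    differentiable, with gradient [- A u] for the velocity
    [A u s = 2 (s - R_nu (u s))]: expanding [E x = int_t |x - Q_nu t|] to first
    order costs only a quadratic remainder ([Ffun_smooth]), so [- A u] is the only
    subgradient ([subdifferential_velocity]) and the inclusion is the ordinary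
    differential equation [g' = A g] in [L_2(0,1)], for a bounded Lipschitz
    vector field [A].

    This equation acts at every level [s] separately. If [s1 < s2], then
    [delta := g t s2 - g t s1] formally satisfies
    [delta' >= 2 (s2 - s1) - (2 / L) delta], and Gronwall's inequality gives the
    announced bound. To give a meaning to values at single levels, the argument
    is run on explicit Euler polygons. They start from [g 0], which is almost
    everywhere equal to [Q_mu0], and they are computed level by level, so that
    each step maps a lower Lipschitz constant [b] to [(1 - 2 tau / L) b + 2 tau]
    ([euler_lower_lipschitz]). As the step tends to [0] these constants tend to
    the stated one ([cvg_exp_compound]), the polygons converge to [g t] in
    [L_2] ([euler_error]), and a subsequence converges almost everywhere
    ([norm2_cvg_ae]). So [g t] has the lower Lipschitz bound on a set of full
    measure ([flow_lower_lipschitz]); this yields its left-continuous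
    representative with the same bound, and the Lipschitz bound for the
    distribution function of its law ([Rplus_pushforward_le]).

    The convergence of the polygons needs the mean value inequality for [g].
    An almost everywhere derivative alone would not give it; the weak derivative
    does, because it bounds the increments of [g] by the integral of a
    scalar function ([W11_increment]). Such a function cannot grow on a null set
    ([ae_right_derivative_le]), hence [|g b - g a - (b - a) c|] is at most
    [M (b - a)] whenever [|g' - c| <= M] almost everywhere
    ([mean_value_ineq]). *)

Import Order.TTheory GRing.Theory Num.Theory.
Import numFieldNormedType.Exports.

Local Open Scope classical_set_scope.
Local Open Scope ring_scope.

Set Implicit Arguments.
Unset Strict Implicit.
Unset Printing Implicit Defensive.

(** * The geometry of L2 *)

Section L2_geometry.
Context {R : realType}.
Implicit Types u v w : L2 R.
Local Notation Lam := (@Lambda01 R).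

Lemma Lambda01_setT : Lam setT = 1%E.
Proof.
rewrite /Lambda01 /= /mrestr setTI lebesgue_measure_itv/= lte_fin ltr01.
by rewrite oppr0 adde0.
Qed.

Lemma Lambda01_lty (A : set R) : measurable A -> (Lam A < +oo)%E.
Proof.
move=> mA; apply: (@le_lt_trans _ _ (Lam setT)).
  by apply: le_measure; rewrite ?inE.
by rewrite Lambda01_setT ltry.
Qed.

Lemma ae_Lambda01 (P : set R) : (forall s, s \in `]0, 1[ -> P s) ->
  {ae Lam, forall s, P s}.
Proof.
move=> h; exists (~` `]0, 1[%classic); split.
- exact: measurableC.
- by rewrite /Lambda01 /= /mrestr setICl measure0.
- by move=> s /= nPs; apply: contra_not nPs => s01; exact: h.
Qed.

Lemma L2_mem u : (u : R -> R) \in Lfun Lam 2%:E.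
Proof. exact: LfunP. Qed.

Lemma L2_measurable u : measurable_fun setT (u : R -> R).
Proof. by have := L2_mem u; rewrite inE => /andP[/[!inE]]. Qed.

Lemma L2_mul_integrable u v : Lam.-integrable setT (EFin \o (fun s => u s * v s)).
Proof. by apply/Lfun1_integrable; apply: Lfun2_mul_Lfun1; exact: L2_mem. Qed.

Lemma L2_integrable_sqr u : Lam.-integrable setT (EFin \o (fun s => u s ^+ 2)).
Proof. exact: (Lfun2_integrable_sqr (L2_mem u)). Qed.

Lemma L2_integrable u : Lam.-integrable setT (EFin \o u).
Proof.
apply/Lfun1_integrable/Lfun_subset12; last exact: L2_mem.
by rewrite Lambda01_setT.
Qed.

(** Evaluation at a point turns identities between vectors into ring
    identities. *)
Lemma L2_valD u v s : (u + v) s = u s + v s. Proof. by []. Qed.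
Lemma L2_valN u s : (- u) s = - u s. Proof. by []. Qed.
Lemma L2_valZ a u s : (a *: u) s = a * u s. Proof. by []. Qed.
Definition L2_val := (L2_valD, L2_valN, L2_valZ).

Lemma norm2_ge0 u : 0 <= norm2 u.
Proof. by rewrite fine_ge0// Lnorm_ge0. Qed.

Lemma norm2_sqr u : norm2 u ^+ 2 = \int[Lam]_s (u s ^+ 2).
Proof.
have h := powR_Lnorm Lam (EFin \o u) (r := 2) (ltac:(by rewrite pnatr_eq0)).
move: h; rewrite -finite_norm_fine -/(norm2 u) poweR_EFin powR_mulrn ?norm2_ge0//.
move=> h; apply: EFin_inj; rewrite h /Rintegral fineK; last first.
  by apply: integrable_fin_num => //; exact: L2_integrable_sqr.
apply: eq_integral => s _ /=; rewrite powR_mulrn// real_normK//.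
exact: num_real.
Qed.

Lemma inner2uu u : inner2 u u = norm2 u ^+ 2.
Proof. by rewrite norm2_sqr /inner2; apply: eq_Rintegral => s _; rewrite expr2. Qed.

Lemma inner2C u v : inner2 u v = inner2 v u.
Proof. by apply: eq_Rintegral => s _; rewrite mulrC. Qed.

Lemma inner2Dl u v w : inner2 (u + v) w = inner2 u w + inner2 v w.
Proof.
rewrite /inner2 -RintegralD//; try exact: L2_mul_integrable.
by apply: eq_Rintegral => s _; rewrite mulrDl.
Qed.

Lemma inner2Zl a u w : inner2 (a *: u) w = a * inner2 u w.
Proof.
rewrite /inner2 -RintegralZl//; try exact: L2_mul_integrable.
by apply: eq_Rintegral => s _; rewrite mulrA.
Qed.

Lemma inner2Nl u w : inner2 (- u) w = - inner2 u w.
Proof. by rewrite -scaleN1r inner2Zl mulN1r. Qed.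

Lemma inner2Bl u v w : inner2 (u - v) w = inner2 u w - inner2 v w.
Proof. by rewrite inner2Dl inner2Nl. Qed.

Lemma inner2_0l w : inner2 0 w = 0.
Proof. by rewrite -(subrr 0) inner2Bl subrr. Qed.

Lemma inner2Zr a u w : inner2 u (a *: w) = a * inner2 u w.
Proof. by rewrite inner2C inner2Zl inner2C. Qed.

Lemma inner2_suml (I : Type) (r : seq I) (F : I -> L2 R) w :
  inner2 (\sum_(i <- r) F i) w = \sum_(i <- r) inner2 (F i) w.
Proof.
elim/big_rec2: _ => [|i x y _ <-]; first exact: inner2_0l.
by rewrite inner2Dl.
Qed.

Lemma norm2D u v : norm2 (u + v) <= norm2 u + norm2 v.
Proof. exact: ler_LnormD. Qed.

Lemma norm2Z a u : norm2 (a *: u) = `|a| * norm2 u.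
Proof.
apply/eqP; rewrite -(@eqrXn2 _ 2)// ?mulr_ge0 ?norm2_ge0//.
by rewrite -inner2uu inner2Zl inner2Zr inner2uu exprMn real_normK ?num_real// mulrA.
Qed.

Lemma norm2N u : norm2 (- u) = norm2 u.
Proof. by rewrite -scaleN1r norm2Z normrN1 mul1r. Qed.

Lemma norm2_0 : norm2 (0 : L2 R) = 0.
Proof. by rewrite -(scale0r 0) norm2Z normr0 mul0r. Qed.

Lemma norm2B u v : norm2 (u - v) = norm2 (v - u).
Proof. by rewrite -norm2N opprB. Qed.

Lemma norm2_triangle v u w : norm2 (u - w) <= norm2 (u - v) + norm2 (v - w).
Proof. by rewrite (le_trans _ (norm2D _ _))// addrA subrK. Qed.

Lemma norm2_ler_dist u v : `|norm2 u - norm2 v| <= norm2 (u - v).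
Proof.
rewrite ler_norml; apply/andP; split.
  rewrite lerNl opprB lerBlDr norm2B -[X in norm2 X <= _](subrK u).
  exact: norm2D.
by rewrite lerBlDr -[X in norm2 X <= _](subrK v); exact: norm2D.
Qed.

Lemma inner2Dr u v w : inner2 w (u + v) = inner2 w u + inner2 w v.
Proof. by rewrite !(inner2C w) inner2Dl. Qed.

Lemma norm2_sqr_comb a b u v : norm2 (a *: u + b *: v) ^+ 2 =
  a ^+ 2 * norm2 u ^+ 2 + 2 * a * b * inner2 u v + b ^+ 2 * norm2 v ^+ 2.
Proof.
rewrite -inner2uu inner2Dl !inner2Dr !inner2Zl !inner2Zr !inner2uu (inner2C v u).
by ring.
Qed.

(** If [c = <u, v>] exceeded [|u| |v|], the quadratic form
    [(x, y) |-> |x u + y v|^2] would be negative at [(c, - |u|^2)], or at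
    [(|v|^2 + 1, - c)] when [|u| = 0]. *)
Lemma inner2_le u v : inner2 u v <= norm2 u * norm2 v.
Proof.
have [|vuv] := leP (inner2 u v) (norm2 u * norm2 v); first by [].
have a0 := norm2_ge0 u; have b0 := norm2_ge0 v.
have := sqr_ge0 (norm2 (inner2 u v *: u + (- norm2 u ^+ 2) *: v)).
have := sqr_ge0 (norm2 ((norm2 v ^+ 2 + 1) *: u + (- inner2 u v) *: v)).
rewrite !norm2_sqr_comb.
set a := norm2 u in vuv a0 *; set b := norm2 v in vuv b0 *.
set c := inner2 u v in vuv *.
have c2 : a ^+ 2 * b ^+ 2 < c ^+ 2.
  by rewrite -exprMn ltr_sqr// ?nnegrE ?mulr_ge0// (le_trans _ (ltW vuv))// mulr_ge0.
have cp : 0 < c ^+ 2 by rewrite (le_lt_trans _ c2)// mulr_ge0// sqr_ge0.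
have [a2|a2] := eqVneq a 0.
  rewrite a2 expr0n/= mulr0 add0r => H _; nra.
have a2p : 0 < a ^+ 2 by rewrite exprn_gt0// lt_neqAle eq_sym a2.
move=> _ H; have : 0 <= a ^+ 2 * (a ^+ 2 * b ^+ 2 - c ^+ 2) by lra.
by rewrite pmulr_rge0// subr_ge0 leNgt c2.
Qed.

Lemma inner2_ler_norm u v : `|inner2 u v| <= norm2 u * norm2 v.
Proof.
rewrite ler_norml inner2_le andbT lerNl -inner2Nl (le_trans (inner2_le _ _))//.
by rewrite norm2N.
Qed.

Lemma norm2_le_ae u v : {ae Lam, forall s, `|u s| <= `|v s|} ->
  norm2 u <= norm2 v.
Proof.
move=> uv; rewrite -ler_sqr ?nnegrE ?norm2_ge0// !norm2_sqr.
rewrite /Rintegral fine_le//.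
- by apply: integrable_fin_num => //; exact: L2_integrable_sqr.
- by apply: integrable_fin_num => //; exact: L2_integrable_sqr.
apply: ae_ge0_le_integral => //.
- by move=> s _; rewrite lee_fin sqr_ge0.
- by have /integrableP[] := L2_integrable_sqr u.
- by move=> s _; rewrite lee_fin sqr_ge0.
- by have /integrableP[] := L2_integrable_sqr v.
- apply: filterS uv => s uvs _; rewrite lee_fin -[leLHS]real_normK ?num_real//.
  by rewrite -[leRHS]real_normK ?num_real// ler_sqr ?nnegrE.
Qed.

Lemma norm2_ae_le u (c : R) : 0 <= c -> {ae Lam, forall s, `|u s| <= c} ->
  norm2 u <= c.
Proof.
move=> c0 uc; rewrite -ler_sqr ?nnegrE ?norm2_ge0// !norm2_sqr.
have -> : c ^+ 2 = fine (\int[Lam]_s (c ^+ 2)%:E).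
  by rewrite integral_cst// Lambda01_setT mule1.
rewrite /Rintegral fine_le//.
- by apply: integrable_fin_num => //; exact: L2_integrable_sqr.
- by rewrite integral_cst// Lambda01_setT mule1.
apply: ae_ge0_le_integral => //.
- by move=> s _; rewrite lee_fin sqr_ge0.
- by have /integrableP[] := L2_integrable_sqr u.
- by move=> s _; rewrite lee_fin sqr_ge0.
- apply: filterS uc => s uvs _; rewrite lee_fin -[leLHS]real_normK ?num_real//.
  by rewrite ler_sqr ?nnegrE.
Qed.

End L2_geometry.

(** * Growth of functions differentiable almost everywhere *)

Lemma integrable_patch (R : realType) (k : R -> R) (U : set (measurableTypeR R)) :
  measurable U -> (@lebesgue_measure R).-integrable U (EFin \o k) ->
  (@lebesgue_measure R).-integrable setT (EFin \o (k \_ U)).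
Proof.
move=> mU ik; rewrite -restrict_EFin.
exact: (proj1 (@integrable_mkcond _ _ _ (@lebesgue_measure R) U (EFin \o k) mU)).
Qed.

Section creeping.
Context {R : realType}.
Local Notation leb := (@lebesgue_measure R).

Lemma Rintegral_itv_cat (k : R -> R) (x y z : R) :
  leb.-integrable setT (EFin \o k) -> x <= y -> y <= z ->
  \int[leb]_(t in `[x, z]) k t =
  \int[leb]_(t in `[x, y]) k t + \int[leb]_(t in `[y, z]) k t.
Proof.
move=> ik xy yz.
have ikS (i : interval R) : leb.-integrable [set` i] (EFin \o k).
  by apply: integrableS ik.
have := @Rintegral_itvB _ k (BLeft x) (BRight z) y (ikS _).
rewrite !bnd_simp => /(_ xy yz); rewrite Rintegral_itv_obnd_cbnd// => <-.
by rewrite addrC subrK.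
Qed.

Lemma Rintegral_itv_split_le (k : R -> R) (x y z : R) :
  (forall t, 0 <= k t) -> leb.-integrable setT (EFin \o k) -> x <= y -> y <= z ->
  \int[leb]_(t in `[x, y]) k t <= \int[leb]_(t in `[x, z]) k t.
Proof.
move=> k0 ik xy yz; rewrite (Rintegral_itv_cat ik xy yz) lerDl.
by apply: Rintegral_ge0 => t _.
Qed.

Lemma integrable_itv_small (k : R -> R) (e : R) : 0 < e ->
  (forall t, 0 <= k t) -> leb.-integrable setT (EFin \o k) ->
  exists2 d, 0 < d & forall x y, x <= y -> y - x < d ->
    \int[leb]_(t in `[x, y]) k t < e.
Proof.
move=> e0 k0 ik; have [d [d0 H]] := integral_normr_continuous ik e0.
exists d => // x y xy yxd.
have -> : \int[leb]_(t in `[x, y]) k t = \int[leb]_(t in `[x, y]) `|k t|.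
  by apply: eq_Rintegral => t _; rewrite ger0_norm.
apply: H; first exact: measurable_itv.
rewrite /= lebesgue_measure_itv/= lte_fin.
by case: ifP => // _; rewrite -EFinD lte_fin.
Qed.

(** The growth is charged to two accounts: at the points where the derivative
    is controlled it costs [M + e] per unit of length, and the remaining points
    lie in an open set [U] over which [k] has integral less than [e]. The largest
    point reached in this way is [b]. *)
Lemma ae_right_derivative_le_eps (f k : R -> R) (a b M : R) : a <= b ->
  (forall t, 0 <= k t) -> leb.-integrable setT (EFin \o k) ->
  (forall x y, a <= x -> x <= y -> y <= b ->
     f y - f x <= \int[leb]_(t in `[x, y]) k t) ->
  {ae leb, forall c, a < c -> c < b -> forall e, 0 < e ->
     exists2 d, 0 < d & forall y, c < y -> y < c + d ->
       f y - f c <= (M + e) * (y - c)} ->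
  0 <= M -> forall e, 0 < e -> f b - f a <= (M + e) * (b - a) + e.
Proof.
move=> ab k0 ik fk [N [mN N0 badN]] M0 e e0.
have [d [d0 Hd]] := integral_normr_continuous ik e0.
have mN' : measurable (N `|` [set a; b]).
  by apply: measurableU => //; apply: measurableU; exact: measurable_set1.
have N'0 : leb (N `|` [set a; b]) = 0%E.
  apply: measure_negligible => //; apply: negligibleU; first by exists N; split.
  apply: negligibleU; (apply/negligibleP; first exact: measurable_set1);
  exact: lebesgue_measure_set1.
have [U [oU NU Ud]] : exists U, [/\ open U, N `|` [set a; b] `<=` U &
    (leb U < d%:E)%E].
  have [|U [oU NU Ud]] := @lebesgue_regularity_outer _ _ d mN' _ d0.
    by rewrite /= N'0.
  exists U; split => //; apply: le_lt_trans Ud.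
  have mU : (R.-ocitv.-measurable).-sigma.-measurable U := open_measurable oU.
  have -> : leb U = (leb (U `&` (N `|` [set a; b])) + leb (U `\` (N `|` [set a; b])))%E.
    by rewrite addeC -measureDI.
  rewrite [X in (X + _)%E](_ : _ = 0%E) ?add0e//.
  apply/eqP; rewrite -measure_le0 -N'0; apply: le_measure; rewrite ?inE//.
  exact: measurableI.
have mU : (R.-ocitv.-measurable).-sigma.-measurable U := open_measurable oU.
pose kU := k \_ U.
have kU0 t : 0 <= kU t by rewrite /kU patchE; case: ifP.
have ikU : leb.-integrable setT (EFin \o kU).
  apply: integrable_patch => //.
  by apply: integrableS ik.
pose G x := \int[leb]_(t in `[a, x]) kU t.
have Gnd x y : a <= x -> x <= y -> G x <= G y.
  by move=> ax xy; exact: Rintegral_itv_split_le.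
have Ge x : G x <= e.
  rewrite (le_trans _ (ltW (Hd U mU Ud)))//.
  rewrite (_ : \int[leb]_(t in U) `|k t| = \int[leb]_(t in U) k t); last first.
    by apply: eq_Rintegral => t _; rewrite ger0_norm.
  rewrite [leRHS]Rintegral_mkcond /G -/kU [leLHS]Rintegral_mkcond.
  apply: le_Rintegral => //.
    apply: integrable_patch => //.
    by apply: integrableS ikU.
  by move=> t _; rewrite patchE; case: ifP.
pose S := [set x | [/\ a <= x, x <= b & f x - f a <= (M + e) * (x - a) + G x]].
have Sa : S a.
  split => //; rewrite !subrr mulr0 add0r; exact: Rintegral_ge0.
have Sub : has_ubound S by exists b => x [].
have hS : has_sup S by split; [exists a|].
pose c := sup S.
have ac : a <= c by exact: ub_le_sup.
have cb : c <= b by apply: ge_sup; [exists a|move=> x []].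
have Sc : S c.
  split => //; apply/ler_addgt0Pr => n n0.
  have [dn dn0 Hn] := integrable_itv_small n0 k0 ik.
  have [x Sx cx] := sup_adherent dn0 hS.
  have xc : x <= c by exact: ub_le_sup.
  have [ax xb fx] := Sx.
  have := fk x c ax xc cb.
  have := Hn x c xc; rewrite ltrBlDr addrC -ltrBlDr => /(_ cx).
  have := Gnd x c ax xc.
  have : (M + e) * (x - a) <= (M + e) * (c - a).
    by rewrite ler_wpM2l ?addr_ge0 ?(ltW e0)// lerB.
  lra.
suff cbE : c = b.
  move: Sc => [_ _]; rewrite cbE => /le_trans; apply.
  by rewrite lerD2l.
apply/eqP; rewrite eq_le cb/= leNgt; apply/negP => {}cb.
(* it remains to advance beyond [c], inside [U] or by the derivative at [c] *)
suff [y cy Sy] : exists2 y, c < y & S y.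
  by have := ub_le_sup Sub Sy; rewrite leNgt cy.
have [Uc|nUc] := pselect (U c).
- have /nbhs_ballP[r /= r0 rU] := open_nbhs_nbhs (conj oU Uc).
  pose y := Num.min b (c + r / 2).
  have cy : c < y by rewrite lt_min cb ltrDl divr_gt0.
  have yb : y <= b by rewrite ge_min lexx.
  exists y => //; split => //; first exact: (le_trans ac (ltW cy)).
  have GE : G y = G c + \int[leb]_(t in `[c, y]) k t.
    rewrite /G (Rintegral_itv_cat ikU ac (ltW cy)); congr (_ + _).
    apply: eq_Rintegral => t; rewrite inE/= in_itv/= => /andP[ct ty].
    rewrite /kU patchE ifT// inE; apply: rU.
    rewrite /ball/= ler0_norm ?subr_le0// opprB ltrBlDl.
    rewrite (le_lt_trans ty)// /y gt_min; apply/orP; right.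
    by rewrite ltrD2l ltr_pdivrMr// ltr_pMr// ltr1n.
  have := fk c y ac (ltW cy) yb.
  case: Sc => _ _.
  have : (M + e) * (c - a) <= (M + e) * (y - a).
    by rewrite ler_wpM2l ?addr_ge0 ?(ltW e0)// lerB// ltW.
  rewrite GE; lra.
- have NNc : ~ (N `|` [set a; b]) c by move=> /NU.
  have ac' : a < c.
    rewrite lt_neqAle ac andbT; apply/eqP => ace.
    by apply: NNc; right; left.
  have good : forall e, 0 < e -> exists2 d, 0 < d & forall y, c < y ->
      y < c + d -> f y - f c <= (M + e) * (y - c).
    apply: contrapT => ngood; apply: NNc; left; apply: badN => /= H.
    by apply: ngood; exact: H.
  have [dc dc0 Hdc] := good _ e0.
  pose y := Num.min b (c + dc / 2).
  have cy : c < y by rewrite lt_min cb ltrDl divr_gt0.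
  have yb : y <= b by rewrite ge_min lexx.
  exists y => //; split => //; first exact: (le_trans ac (ltW cy)).
  have := Hdc y cy; rewrite /y gt_min ltrD2l (ltr_pdivrMr dc)// ltr_pMr// ltr1n orbT.
  rewrite -/y => /(_ isT).
  have := Gnd c y ac (ltW cy).
  by case: Sc => _ _; lra.
Qed.

(** A function whose increments are bounded by the integral of some [m] cannot
    grow on a null set. This excludes Cantor-like functions, for which an
    almost everywhere bound on the right derivative says nothing. *)
Lemma ae_right_derivative_le (f m : R -> R) (a b M : R) : a <= b -> 0 <= M ->
  (forall t, t \in `[a, b] -> 0 <= m t) ->
  leb.-integrable `[a, b] (EFin \o m) ->
  (forall x y, a <= x -> x <= y -> y <= b ->
     f y - f x <= \int[leb]_(t in `[x, y]) m t) ->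
  {ae leb, forall c, a < c -> c < b -> forall e, 0 < e ->
     exists2 d, 0 < d & forall y, c < y -> y < c + d ->
       f y - f c <= (M + e) * (y - c)} ->
  f b - f a <= M * (b - a).
Proof.
move=> ab M0 m0 im fm good.
have ik : leb.-integrable setT (EFin \o (m \_ `[a, b])).
  exact: integrable_patch.
have k0 t : 0 <= (m \_ `[a, b]) t.
  by rewrite patchE; case: ifP => //; rewrite inE => /m0.
have fk x y : a <= x -> x <= y -> y <= b ->
    f y - f x <= \int[leb]_(t in `[x, y]) (m \_ `[a, b]) t.
  move=> ax xy yb; rewrite (le_trans (fm _ _ ax xy yb))// le_eqVlt; apply/orP; left.
  apply/eqP/eq_Rintegral => t; rewrite inE/= in_itv/= => /andP[xt ty].
  by rewrite patchE ifT// inE/= in_itv/= (le_trans ax xt) (le_trans ty yb).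
apply/ler_addgt0Pr => e e0.
pose e' := e / (b - a + 1).
have ba1 : 0 < b - a + 1 by rewrite ltr_wpDl// subr_ge0.
have e'0 : 0 < e' by rewrite divr_gt0.
have := ae_right_derivative_le_eps ab k0 ik fk good M0 e'0.
rewrite mulrDl -addrA => /le_trans; apply; rewrite lerD2l.
by rewrite -[X in _ + X]mulr1 -mulrDr /e' divfK ?gt_eqF.
Qed.

End creeping.

(** * Smoothed indicators of intervals *)

Section test_functions.
Context {R : realType}.
Local Notation leb := (@lebesgue_measure R).

Implicit Types a b e t x y h T : R.

Definition sqpos (x : R) : R := Num.max 0 x ^+ 2.

(** The positive part is the derivative of half of [sqpos], with a remainder
    that is uniform across the kink at [0]: sums of translates of [sqpos] are
    differentiable without gluing conditions. *)
Lemma sqpos_taylor x h :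
  0 <= sqpos (x + h) - sqpos x - 2 * Num.max 0 x * h <= h ^+ 2.
Proof.
by rewrite /sqpos; apply/andP; split; case: (leP 0 (x + h)); case: (leP 0 x);
  move=> ? ?; rewrite ?expr0n/=; nra.
Qed.

Lemma is_derive_quadratic (f : R -> R) (x l C : R) : 0 <= C ->
  (forall h, `|f (x + h) - f x - l * h| <= C * h ^+ 2) -> is_derive x 1 f l.
Proof.
move=> C0 H.
have K : h^-1 *: ((f \o shift x) (h *: 1) - f x) @[h --> 0^'] --> l.
  apply/cvgrPdist_le => e e0.
  near=> h.
  have h0 : h != 0 by near: h; exact: nbhs_dnbhs_neq.
  rewrite /= -[h *: 1]mulrC mul1r (addrC h x) -[_ *: _]/(h^-1 * _).
  have hp : 0 < `|h| by rewrite normr_gt0.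
  rewrite -(ler_pM2r hp) -normrM mulrBl mulrAC mulVf// mul1r -normrN opprB.
  rewrite (le_trans (H h))// -[h ^+ 2]real_normK ?num_real// expr2 mulrA.
  rewrite ler_wpM2r//.
  have : `|h| <= e / (C + 1).
    near: h; apply: dnbhs0_le; rewrite divr_gt0// ltr_wpDl//.
  rewrite ler_pdivlMr ?ltr_wpDl// => /(le_trans _); apply.
  by rewrite mulrC ler_wpM2l// lerDl.
split; first by apply/cvg_ex; exists l.
exact: cvg_lim.
Unshelve. all: end_near. Qed.

(** The hat function on [[a, a + 2 e]] with integral [1], written as a second
    difference of the positive part. *)
Definition tri (a e t : R) : R :=
  (Num.max 0 (t - a) - 2 * Num.max 0 (t - (a + e)) + Num.max 0 (t - (a + 2 * e)))
  / e ^+ 2.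

(** The primitive of [tri] rising from [0] to [1]: the corresponding second
    difference of [sqpos]. *)
Definition ramp (a e t : R) : R :=
  (sqpos (t - a) - 2 * sqpos (t - (a + e)) + sqpos (t - (a + 2 * e)))
  / (2 * e ^+ 2).

Lemma tri_ge0 a e t : 0 < e -> 0 <= tri a e t.
Proof.
move=> e0; apply: divr_ge0; last by rewrite sqr_ge0.
by case: (leP 0 (t - a)); case: (leP 0 (t - (a + e)));
  case: (leP 0 (t - (a + 2 * e))) => ? ? ?; lra.
Qed.

Lemma tri_out a e t : 0 < e -> t \notin `[a, a + 2 * e] -> tri a e t = 0.
Proof.
move=> e0; rewrite in_itv/= negb_and -!ltNge => /orP ht.
rewrite /tri (_ : _ + _ = 0) ?mul0r//.
by move: ht; case: (leP 0 (t - a)); case: (leP 0 (t - (a + e)));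
  case: (leP 0 (t - (a + 2 * e))) => ? ? ? [] ?; lra.
Qed.

Lemma ramp_l a e t : 0 < e -> t <= a -> ramp a e t = 0.
Proof.
move=> e0 ta; rewrite /ramp /sqpos (@max_l _ _ 0 (t - a)); last by lra.
rewrite (@max_l _ _ 0 (t - (a + e))); last by lra.
rewrite (@max_l _ _ 0 (t - (a + 2 * e))); last by lra.
by rewrite expr0n/= mulr0 subrr add0r mul0r.
Qed.

Lemma ramp_r a e t : 0 < e -> a + 2 * e <= t -> ramp a e t = 1.
Proof.
move=> e0 ta; rewrite /ramp /sqpos (@max_r _ _ 0 (t - a)); last by lra.
rewrite (@max_r _ _ 0 (t - (a + e))); last by lra.
rewrite (@max_r _ _ 0 (t - (a + 2 * e))); last by lra.
by field; rewrite gt_eqF.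
Qed.

Lemma ramp01 a e t : 0 < e -> 0 <= ramp a e t <= 1.
Proof.
move=> e0; rewrite /ramp /sqpos.
have e2 : 0 < 2 * e ^+ 2 by rewrite mulr_gt0// exprn_gt0.
apply/andP; split; rewrite ?ler_pdivlMr// ?ler_pdivrMr// ?mul0r ?mul1r.
- by case: (leP 0 (t - a)); case: (leP 0 (t - (a + e)));
  case: (leP 0 (t - (a + 2 * e))) => ? ? ?; rewrite ?expr0n/=; nra.
- by case: (leP 0 (t - a)); case: (leP 0 (t - (a + e)));
  case: (leP 0 (t - (a + 2 * e))) => ? ? ?; rewrite ?expr0n/=; nra.
Qed.

Lemma ramp_taylor a e t h : 0 < e ->
  `|ramp a e (t + h) - ramp a e t - tri a e t * h| <= 2 / e ^+ 2 * h ^+ 2.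
Proof.
move=> e0; rewrite /ramp /tri.
have tE x : t + h - x = (t - x) + h by ring.
rewrite !tE.
have := sqpos_taylor (t - a) h; have := sqpos_taylor (t - (a + e)) h.
have := sqpos_taylor (t - (a + 2 * e)) h.
set x0 := sqpos (t - (a + 2 * e) + h); set x1 := sqpos (t - (a + 2 * e)).
set x2 := sqpos (t - (a + e) + h); set x3 := sqpos (t - (a + e)).
set x4 := sqpos (t - a + h); set x5 := sqpos (t - a).
set y0 := Num.max 0 (t - (a + 2 * e)); set y1 := Num.max 0 (t - (a + e)).
set y2 := Num.max 0 (t - a) => /andP[? ?] /andP[? ?] /andP[? ?].
have e2 : 0 < e ^+ 2 by rewrite exprn_gt0.
set X := (X in `|X|).
have -> : X = ((x4 - 2 * x2 + x0) - (x5 - 2 * x3 + x1) - 2 * (y2 - 2 * y1 + y0) * h)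
   / (2 * e ^+ 2) by rewrite /X; field; rewrite gt_eqF.
rewrite normrM [`|_^-1|]gtr0_norm ?invr_gt0 ?mulr_gt0//.
rewrite ler_pdivrMr ?mulr_gt0//.
have -> : 2 / e ^+ 2 * h ^+ 2 * (2 * e ^+ 2) = 4 * h ^+ 2.
  by field; rewrite gt_eqF.
have := sqr_ge0 h.
by rewrite ler_norml; move=> ?; apply/andP; split; lra.
Qed.

Lemma continuous_tri a e : continuous (tri a e).
Proof.
have cm b : continuous (fun t : R => Num.max 0 (t - b)).
  move=> t.
  apply: (@continuous_max R R (cst 0) (fun t => t - b) t); first exact: cvg_cst.
  by apply: cvgB; [exact: cvg_id|exact: cvg_cst].
move=> t; apply: cvgM; last exact: cvg_cst.
apply: cvgD; last exact: cm.
by apply: cvgB; [exact: cm|apply: cvgM; [exact: cvg_cst|exact: cm]].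
Qed.

Lemma is_derive_ramp a e t : 0 < e -> is_derive t 1 (ramp a e) (tri a e t).
Proof.
move=> e0; apply: (@is_derive_quadratic _ _ _ (2 / e ^+ 2)).
  by rewrite divr_ge0// sqr_ge0.
by move=> h; exact: ramp_taylor.
Qed.

Lemma tri_integrable a e (x y : R) : leb.-integrable `[x, y] (EFin \o tri a e).
Proof.
apply: continuous_compact_integrable; first exact: segment_compact.
exact/continuous_subspaceT/continuous_tri.
Qed.

Lemma Rintegral_tri a e (x y : R) : 0 < e -> x <= a -> a + 2 * e <= y ->
  \int[leb]_(t in `[x, y]) tri a e t = 1.
Proof.
move=> e0 xa ay; have xy : x < y by lra.
rewrite /Rintegral (@continuous_FTC2 _ (tri a e) (ramp a e))//.
- by rewrite -EFinB/= ramp_r// ramp_l// subr0.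
- exact/continuous_subspaceT/continuous_tri.
- have cr : continuous (ramp a e).
    move=> t; apply: differentiable_continuous; apply/derivable1_diffP.
    by have [] := @is_derive_ramp a e t e0.
  split.
  + by move=> t _; have [] := @is_derive_ramp a e t e0.
  + exact/cvg_at_right_filter/cr.
  + exact/cvg_at_left_filter/cr.
- by move=> t _; rewrite derive1E; have := @is_derive_ramp a e t e0 => -[].
Qed.

Definition trapeze (a b e t : R) : R := ramp a e t - ramp (b - 2 * e) e t.

Lemma derive1_trapeze a b e t : 0 < e ->
  derive1 (trapeze a b e) t = tri a e t - tri (b - 2 * e) e t.
Proof.
move=> e0; rewrite derive1E.
have [_ <-] := is_deriveB (is_derive_ramp a t e0) (is_derive_ramp (b - 2 * e) t e0).
by [].
Qed.

Lemma trapeze_bounds a b e t : 0 < e -> a + 2 * e <= b - 2 * e ->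
  0 <= trapeze a b e t <= 1.
Proof.
move=> e0 ab; rewrite /trapeze.
have := @ramp01 a e t e0; have := @ramp01 (b - 2 * e) e t e0.
have [tb|/ltW tb] := leP t (b - 2 * e); first by rewrite (ramp_l _ tb)//; lra.
by rewrite (@ramp_r a e t)//; lra.
Qed.

Lemma trapeze_out a b e t : 0 < e -> a + 2 * e <= b - 2 * e ->
  t \notin `[a, b] -> trapeze a b e t = 0.
Proof.
move=> e0 ab; rewrite in_itv/= negb_and -!ltNge => /orP[|] ht; rewrite /trapeze.
  by rewrite !ramp_l ?subr0//; lra.
by rewrite !ramp_r ?subrr//; lra.
Qed.

Lemma trapeze_test T a b e : 0 < a -> b < T -> 0 < e -> a + 2 * e <= b - 2 * e ->
  test_function T (trapeze a b e).
Proof.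
move=> a0 bT e0 ab; split.
- move=> t.
  by have [] := is_deriveB (is_derive_ramp a t e0) (is_derive_ramp (b - 2 * e) t e0).
- have -> : derive1 (trapeze a b e) = (fun t => tri a e t - tri (b - 2 * e) e t).
    by apply/funext => t; rewrite derive1_trapeze.
  by move=> t; apply: cvgB; exact: continuous_tri.
- exists a, b; split => //; first by lra.
  by move=> t; exact: trapeze_out.
Qed.

End test_functions.

(** * Bochner integrals and weak derivatives *)

Section Bochner_bounds.
Context {R : realType}.
Local Notation leb := (@lebesgue_measure R).
Implicit Types (D : set (measurableTypeR R)) (f g h : R -> L2 R) (w : L2 R).

Lemma indic_integrable (A D : set (measurableTypeR R)) : measurable D ->
  measurable A -> (leb A < +oo)%E -> leb.-integrable D (EFin \o \1_A).
Proof.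
move=> mD mA Afin; apply: (@integrableS _ _ _ leb setT) => //.
apply/integrableP; split; first exact/measurable_EFinP.
under eq_integral => t _ do rewrite /= ger0_norm//.
by rewrite integral_indic// setIT.
Qed.

Lemma step_integrable n (A : 'I_n -> set (measurableTypeR R)) (c : 'I_n -> R) D :
  measurable D ->
  (forall i, [/\ measurable (A i), A i `<=` D & (leb (A i) < +oo)%E]) ->
  leb.-integrable D (EFin \o (fun t => \sum_i \1_(A i) t * c i)).
Proof.
move=> mD hA.
rewrite (_ : _ \o _ = (fun t => \sum_i (\1_(A i) t * c i)%:E)%E); last first.
  by apply/funext => t /=; rewrite sumEFin.
apply: (@integrable_sum _ _ _ leb) => // i _.
rewrite (_ : (fun t => _) = (fun t => (c i)%:E * (\1_(A i) t)%:E)%E); last first.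
  by apply/funext => t; rewrite mulrC EFinM.
apply: integrableZl => //; have [mA AD Afin] := hA i.
exact: indic_integrable.
Qed.

Lemma Rintegral_step n (A : 'I_n -> set (measurableTypeR R)) (c : 'I_n -> R) D :
  measurable D ->
  (forall i, [/\ measurable (A i), A i `<=` D & (leb (A i) < +oo)%E]) ->
  \int[leb]_(t in D) (\sum_i \1_(A i) t * c i) = \sum_i fine (leb (A i)) * c i.
Proof.
move=> mD hA; apply: EFin_inj.
rewrite /Rintegral fineK; last first.
  by apply: integrable_fin_num => //; exact: step_integrable.
have iA i : leb.-integrable D (EFin \o \1_(A i)).
  have [mA AD Afin] := hA i.
  exact: indic_integrable.
have iAc i : leb.-integrable D (fun t => (\1_(A i) t * c i)%:E).
  rewrite (_ : (fun t => _) = (fun t => (c i)%:E * (\1_(A i) t)%:E)%E); last first.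
    by apply/funext => t; rewrite mulrC EFinM.
  by apply: integrableZl => //; exact: iA.
transitivity (\int[leb]_(t in D) (\sum_i (\1_(A i) t * c i)%:E))%E.
  by apply: eq_integral => t _; rewrite sumEFin.
rewrite (@integral_sum _ _ _ leb D mD _ (fun i t => (\1_(A i) t * c i)%:E) iAc).
rewrite -sumEFin; apply: eq_bigr => i _.
under eq_integral do rewrite mulrC EFinM.
rewrite integralZl//; last exact: iA.
have [mA AD Afin] := hA i.
rewrite integral_indic// setIidl// mulrC EFinM fineK// ge0_fin_numE//.
Qed.

(** Pairing with a fixed vector turns step integrals into scalar integrals and
    is continuous, so bounds pass to the limit. The function [t |-> <f t, w>] is
    only an almost everywhere limit of measurable ones; therefore an integrable
    majorant [M] takes its place. *)
Lemma bochner_inner_le D f I w (M : R -> R) : measurable D ->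
  bochner_integral D f I -> leb.-integrable D (EFin \o M) ->
  (forall t, D t -> inner2 (f t) w <= M t) ->
  inner2 I w <= \int[leb]_(t in D) M t.
Proof.
move=> mD [n [A [v [hA mN cN cI]]]] iM fM.
pose N k t := norm2 (f t - step_fun (A k) (v k) t).
have N0 k t : 0 <= N k t by exact: norm2_ge0.
have stepE k t : inner2 (step_fun (A k) (v k) t) w =
    \sum_i \1_(A k i) t * inner2 (v k i) w.
  by rewrite inner2_suml; apply: eq_bigr => i _; rewrite inner2Zl.
have bound k (e : R) : 0 < e -> (\int[leb]_(t in D) (N k t)%:E < e%:E)%E ->
    inner2 (step_integral (A k) (v k)) w <= \int[leb]_(t in D) M t + norm2 w * e.
  move=> e0 Nk.
  have iN : leb.-integrable D (EFin \o N k).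
    apply/integrableP; split; first by apply/measurable_EFinP; exact: mN.
    under eq_integral => t _ do rewrite /= ger0_norm//.
    by rewrite (lt_trans Nk)// ltry.
  have iwN : leb.-integrable D (EFin \o (fun t => norm2 w * N k t)).
    rewrite (_ : _ \o _ = (fun t => (norm2 w)%:E * (N k t)%:E)%E)//.
    exact: integrableZl.
  rewrite inner2_suml; under eq_bigr do rewrite inner2Zl.
  rewrite -(Rintegral_step _ mD)//.
  apply: (@le_trans _ _ (\int[leb]_(t in D) (M t + norm2 w * N k t))).
    apply: le_Rintegral => //.
    - exact: step_integrable.
    - by rewrite (_ : _ \o _ = (EFin \o M) \+ (EFin \o (fun t => norm2 w * N k t)))//;
        exact: integrableD.
    - move=> t Dt; rewrite -stepE.
      have -> : step_fun (A k) (v k) t = f t - (f t - step_fun (A k) (v k) t).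
        by rewrite opprB addrC subrK.
      rewrite inner2Bl lerD ?fM// -inner2Nl (le_trans (inner2_le _ _))//.
      by rewrite norm2N mulrC.
  rewrite RintegralD// lerD2l RintegralZl// ler_wpM2l ?norm2_ge0//.
  rewrite -lee_fin /Rintegral fineK ?ltW//.
  by apply: integrable_fin_num.
apply/ler_addgt0Pr => e e0.
have w1 : 0 < 2 * norm2 w + 1 by rewrite ltr_wpDl// mulr_ge0// norm2_ge0.
pose e' := e / (2 * norm2 w + 1).
have e'0 : 0 < e' by rewrite divr_gt0.
have [k [Nk Ik]] : exists k, (\int[leb]_(t in D) (N k t)%:E < e'%:E)%E /\
    norm2 (step_integral (A k) (v k) - I) < e'.
  have /fine_cvgP[[k1 _ fink] /cvgrPdist_lt /(_ _ e'0)[k2 _ H2]] := cN.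
  have /cvgrPdist_lt /(_ _ e'0)[k3 _ H3] := cI.
  pose k := maxn k1 (maxn k2 k3); exists k.
  have kk1 : (k1 <= k)%N by rewrite leq_max leqnn.
  have kk2 : (k2 <= k)%N by rewrite /k !leq_max leqnn orbT.
  have kk3 : (k3 <= k)%N by rewrite /k !leq_max leqnn !orbT.
  split.
  - have := H2 k kk2; rewrite /= sub0r normrN ger0_norm; last first.
      by apply/fine_ge0/integral_ge0 => t _; rewrite lee_fin norm2_ge0.
    by rewrite -lte_fin fineK//; exact: fink.
  - by have := H3 k kk3; rewrite /= sub0r normrN ger0_norm ?norm2_ge0.
have := bound k e' e'0 Nk.
have : inner2 I w - inner2 (step_integral (A k) (v k)) w <= e' * norm2 w.
  rewrite -inner2Bl (le_trans (inner2_le _ _))// ler_wpM2r ?norm2_ge0//.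
  by rewrite norm2B ltW.
have : e' * (2 * norm2 w) <= e.
  rewrite /e' mulrAC ler_pdivrMr// ler_wpM2l// ?(ltW e0)//.
  by rewrite lerDl.
lra.
Qed.

Lemma continuous_on_nonneg_dist g t (e : R) : continuous_on_nonneg g -> 0 <= t ->
  0 < e -> exists2 d, 0 < d &
    forall r, 0 <= r -> `|r - t| < d -> norm2 (g r - g t) < e.
Proof.
move=> cg t0 e0; have /cvgrPdist_lt /(_ _ e0) := cg t t0.
rewrite /prop_near1 /within/= => /nbhs_ballP[d/= d0 H]; exists d => // r r0 rt.
have := H r; rewrite /ball/= distrC => /(_ rt).
by rewrite in_itv/= r0 => /(_ isT); rewrite sub0r normrN ger0_norm ?norm2_ge0.
Qed.

Lemma Rintegral_tri_oo (a e T : R) : 0 < e -> 0 < a -> a + 2 * e < T ->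
  \int[leb]_(t in `]0, T[) tri a e t = 1.
Proof.
move=> e0 a0 aT.
rewrite Rintegral_itv_bndo_bndc; last first.
  by apply: integrableS (tri_integrable a e 0 T) => //; exact: subset_itv_oo_cc.
rewrite Rintegral_itv_obnd_cbnd; last first.
  by apply: integrableS (tri_integrable a e 0 T) => //; exact: subset_itv_oc_cc.
by rewrite Rintegral_tri// ltW.
Qed.

(** The test functions are smoothed indicators [phi] of [[a, b]], and everything
    is paired with [w = g b - g a]. The integral of [phi' g] then tends to
    [- |w|^2], while the opposite quantity, the integral of [phi h], is at most
    [|w|] times the integral over [[a, b]] of a majorant [m] of [|h|]. The norm of
    [h] may fail to be measurable; [m] is the distance from [h] to one of its step
    approximations plus a bound for the norm of the latter. *)
Lemma W11_increment T g (d : R) : W11 T g -> continuous_on_nonneg g ->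
  0 < d -> d < T -> exists m : R -> R,
  [/\ forall t, 0 <= m t, leb.-integrable `]d, T[ (EFin \o m) &
      forall a b, d < a -> a <= b -> b < T ->
        norm2 (g b - g a) <= \int[leb]_(t in `[a, b]) m t].
Proof.
move=> [_ [h wh ih]] cg d0 dT.
have [I [n [A [v [hA mN cN _]]]]] := ih d (ltac:(by rewrite d0 dT)).
have [k Nk] : exists k,
    (\int[leb]_(t in `]d, T[) (norm2 (h t - step_fun (A k) (v k) t))%:E < +oo)%E.
  have /fine_cvgP[[k _ fink] _] := cN; exists k.
  by have := fink k (leqnn k); rewrite ge0_fin_numE// integral_ge0// => t _;
    rewrite lee_fin norm2_ge0.
pose m t := norm2 (h t - step_fun (A k) (v k) t) +
  \sum_i \1_(A k i) t * norm2 (v k i).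
have s0 t : 0 <= \sum_i \1_(A k i) t * norm2 (v k i).
  by apply: sumr_ge0 => i _; rewrite mulr_ge0// norm2_ge0.
have m0 t : 0 <= m t by rewrite addr_ge0// norm2_ge0.
have hm t : norm2 (h t) <= m t.
  rewrite -[X in norm2 X <= _](subrK (step_fun (A k) (v k) t)).
  rewrite (le_trans (norm2D _ _))// lerD2l /step_fun.
  elim/big_rec2: _ => [|i x y _ yx]; first by rewrite norm2_0.
  by rewrite (le_trans (norm2D _ _))// lerD// norm2Z ger0_norm.
have im : leb.-integrable `]d, T[ (EFin \o m).
  rewrite (_ : _ \o _ = (EFin \o (fun t => norm2 (h t - step_fun (A k) (v k) t))) \+
    (EFin \o (fun t => \sum_i \1_(A k i) t * norm2 (v k i))))//.
  apply: integrableD => //; last exact: step_integrable.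
  apply/integrableP; split; first by apply/measurable_EFinP; exact: mN.
  by under eq_integral => t _ do rewrite /= ger0_norm ?norm2_ge0//.
exists m; split => // a b da ab bT.
have a0 : 0 < a := lt_trans d0 da.
move: ab; rewrite le_eqVlt => /predU1P[->|ab].
  by rewrite subrr norm2_0; exact: Rintegral_ge0.
set w := g b - g a.
have sab : `[a, b] `<=` `]d, T[.
  move=> t /=; rewrite !in_itv/= => /andP[at_ tb].
  by rewrite (lt_le_trans da at_) (le_lt_trans tb bT).
have imab : leb.-integrable `[a, b] (EFin \o m).
  by apply: integrableS im.
have key (e : R) : 0 < e ->
    norm2 w ^+ 2 <= 2 * e * norm2 w + norm2 w * \int[leb]_(t in `[a, b]) m t.
  move=> e0.
  have [ra ra0 Ha] := continuous_on_nonneg_dist cg (ltW a0) e0.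
  have [rb rb0 Hb] := continuous_on_nonneg_dist cg (ltW (lt_trans a0 ab)) e0.
  (* the two hats, of width [2 r], are disjoint and [g] varies by at most [e] on each *)
  pose r := Num.min (Num.min (ra / 3) (rb / 3)) ((b - a) / 4).
  have r0 : 0 < r by rewrite !lt_min !divr_gt0// subr_gt0.
  have rra : r <= ra / 3 by rewrite /r !ge_min lexx.
  have rrb : r <= rb / 3 by rewrite /r !ge_min lexx orbT.
  have rba : r <= (b - a) / 4 by rewrite /r !ge_min lexx orbT.
  have abr : a + 2 * r <= b - 2 * r by lra.
  have [J [bJ1 bJ2]] := wh _ (trapeze_test a0 bT r0 abr).
  pose M1 t := (inner2 (g a) w + e * norm2 w) * tri a r t -
               (inner2 (g b) w - e * norm2 w) * tri (b - 2 * r) r t.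
  have itri c : leb.-integrable `]0, T[ (EFin \o tri c r).
    by apply: integrableS (tri_integrable c r 0 T) => //; exact: subset_itv_oo_cc.
  have itriZ c x : leb.-integrable `]0, T[ (EFin \o (fun t => x * tri c r t)).
    rewrite (_ : _ \o _ = (fun t => x%:E * (tri c r t)%:E)%E)//.
    by apply: integrableZl => //; exact: itri.
  have iM1 : leb.-integrable `]0, T[ (EFin \o M1).
    exact: (integrableB _ (itriZ a _) (itriZ (b - 2 * r) _)).
  have J1 : inner2 J w <= \int[leb]_(t in `]0, T[) M1 t.
    apply: bochner_inner_le bJ1 iM1 _ => // t; rewrite /= in_itv/= => /andP[t0 tT].
    rewrite inner2Zl derive1_trapeze// mulrBl /M1 lerB//.
    - have [tin|tout] := boolP (t \in `[a, a + 2 * r]); last first.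
        by rewrite (tri_out r0 tout) mul0r mulr0.
      rewrite mulrC ler_wpM2r ?tri_ge0// -lerBlDl -inner2Bl.
      rewrite (le_trans (inner2_le _ _))// ler_wpM2r ?norm2_ge0// ltW//.
      apply: Ha; first exact: ltW.
      by move: tin; rewrite in_itv/= => /andP[? ?]; rewrite ger0_norm; lra.
    - have [tin|tout] := boolP (t \in `[b - 2 * r, b - 2 * r + 2 * r]); last first.
        by rewrite (tri_out r0 tout) mul0r mulr0.
      rewrite [leRHS]mulrC ler_wpM2r ?tri_ge0// lerBlDl -lerBlDr -inner2Bl.
      rewrite (le_trans (inner2_le _ _))// ler_wpM2r ?norm2_ge0// norm2B ltW//.
      apply: Hb; first exact: ltW.
      by move: tin; rewrite in_itv/= => /andP[? ?]; rewrite ler0_norm; lra.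
  have M1E : \int[leb]_(t in `]0, T[) M1 t =
      inner2 (g a) w - inner2 (g b) w + 2 * e * norm2 w.
    rewrite (RintegralB _ (itriZ a _) (itriZ (b - 2 * r) _))//.
    rewrite !(RintegralZl _ _ (itri _))// (Rintegral_tri_oo r0 a0); last by lra.
    rewrite (@Rintegral_tri_oo (b - 2 * r) r T r0); lra.
  have J2 : inner2 (- J) w <= \int[leb]_(t in `]0, T[) (norm2 w * (m \_ `[a, b]) t).
    apply: bochner_inner_le bJ2 _ _ => //.
      rewrite (_ : _ \o _ = (fun t => (norm2 w)%:E * ((m \_ `[a, b]) t)%:E)%E)//.
      apply: integrableZl => //.
      apply: (@integrableS _ _ _ leb setT) => //.
      exact: integrable_patch.
    move=> t _; rewrite inner2Zl.
    have [tin|tout] := boolP (t \in `[a, b]); last first.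
      rewrite trapeze_out// mul0r mulr_ge0 ?norm2_ge0// patchE.
      by case: ifP.
    rewrite patchE ifT; last by rewrite inE.
    have /andP[p0 p1] := @trapeze_bounds _ a b r t r0 abr.
    rewrite (le_trans (ler_norm _))// normrM (ger0_norm p0).
    apply: (@le_trans _ _ `|inner2 (h t) w|); first by rewrite ler_piMl.
    rewrite (le_trans (inner2_ler_norm _ _))// mulrC ler_wpM2l ?norm2_ge0//.
  have M2E : \int[leb]_(t in `]0, T[) (norm2 w * (m \_ `[a, b]) t) =
      norm2 w * \int[leb]_(t in `[a, b]) m t.
    rewrite RintegralZl//; last first.
      by apply: (@integrableS _ _ _ leb setT) => //; exact: integrable_patch.
    rewrite -Rintegral_mkcondr setIidr//.
    by apply: subset_trans sab _; apply: subset_itvr; rewrite bnd_simp ltW.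
  have : norm2 w ^+ 2 = inner2 (g b) w - inner2 (g a) w.
    by rewrite -inner2Bl -inner2uu.
  move: J1 J2; rewrite M1E M2E inner2Nl; lra.
have [w0|w0] := eqVneq (norm2 w) 0; first by rewrite w0; exact: Rintegral_ge0.
have wp : 0 < norm2 w by rewrite lt_neqAle eq_sym w0 norm2_ge0.
apply/ler_addgt0Pr => e e0.
have := key (e / 2) (divr_gt0 e0 (ltr0n _ 2)).
have -> : 2 * (e / 2) * norm2 w + norm2 w * \int[leb]_(t in `[a, b]) m t =
  norm2 w * (\int[leb]_(t in `[a, b]) m t + e) by field.
by rewrite expr2 ler_pM2l.
Qed.

End Bochner_bounds.

(** * Flows of bounded Lipschitz vector fields *)

Lemma ae_lebesgueW (R : realType) (P Q : R -> Prop) : (forall t, P t -> Q t) ->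
  {ae @lebesgue_measure R, forall t, P t} -> {ae @lebesgue_measure R, forall t, Q t}.
Proof.
move=> PQ; exact: (@filterS _ _ (ae_filter_ringOfSetsType (@lebesgue_measure R)) _ _ PQ).
Qed.

Section Lipschitz_flow.
Context {R : realType}.
Local Notation leb := (@lebesgue_measure R).
Implicit Types (g : R -> L2 R) (u v c : L2 R) (a b t : R).

Lemma strong_derivative_right g t d : strong_derivative g t d ->
  forall e : R, 0 < e -> exists2 r, 0 < r & forall y, t < y -> y < t + r ->
    norm2 ((y - t)^-1 *: (g y - g t) - d) < e.
Proof.
move=> + e e0 => /cvgrPdist_lt /(_ _ e0).
rewrite /prop_near1 /dnbhs /within/= => /nbhs_ballP[r/= r0 H]; exists r => // y ty ytr.
have := H y; rewrite /ball/= distrC ger0_norm ?subr_ge0 ?(ltW ty)//.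
rewrite ltrBlDl => /(_ ytr); rewrite gt_eqF// => /(_ isT).
by rewrite sub0r normrN ger0_norm// norm2_ge0.
Qed.

(** The scalar function [t |-> |g t - g a - (t - a) c|] has increments bounded
    by the integral of [m + |c|], and right derivative at most [|g' - c|]. *)
Lemma mean_value_pos T g c a b (M : R) : W11 T g -> continuous_on_nonneg g ->
  0 < a -> a <= b -> b < T -> 0 <= M ->
  {ae leb, forall t, a < t -> t < b ->
     exists2 d, strong_derivative g t d & norm2 (d - c) <= M} ->
  norm2 (g b - g a - (b - a) *: c) <= M * (b - a).
Proof.
move=> Wg cg a0 ab bT M0 gd.
have a2 : 0 < a / 2 by rewrite divr_gt0.
have [m [m0 im mg]] := @W11_increment _ T g (a / 2) Wg cg a2 (ltac:(lra)).
pose f t := norm2 (g t - g a - (t - a) *: c).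
have fE x y : f y - f x <= norm2 (g y - g x - (y - x) *: c).
  rewrite (le_trans (ler_norm _))// (le_trans (norm2_ler_dist _ _))//.
  rewrite le_eqVlt; apply/orP; left; apply/eqP; congr norm2.
  by apply/LfuneqP => s; rewrite !L2_val; ring.
have fa : f a = 0 by rewrite /f !subrr scale0r subrr norm2_0.
rewrite -/(f b) -[f b]subr0 -fa.
have isub : leb.-integrable `[a, b] (EFin \o m).
  apply: integrableS im => //.
  by move=> t /=; rewrite !in_itv/= => /andP[? ?]; apply/andP; split; lra.
have icst x y : leb.-integrable `[x, y] (EFin \o cst (norm2 c)).
  by apply: continuous_compact_integrable; [exact: segment_compact|
    exact/continuous_subspaceT/cst_continuous].
apply: (@ae_right_derivative_le _ f (fun t => m t + norm2 c)) => //.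
- by move=> t _; rewrite addr_ge0// norm2_ge0.
- rewrite (_ : _ \o _ = (EFin \o m) \+ (EFin \o cst (norm2 c)))//.
  exact: integrableD.
- move=> x y ax xy yb.
  have ixy : leb.-integrable `[x, y] (EFin \o m).
    apply: integrableS isub => // t /=.
    by rewrite !in_itv/= => /andP[? ?]; apply/andP; split; lra.
  rewrite RintegralD//.
  rewrite (le_trans (fE _ _))// (le_trans (norm2D _ _))//.
  rewrite norm2N norm2Z ger0_norm ?subr_ge0// lerD//.
    by apply: mg => //; lra.
  rewrite Rintegral_cst//= lebesgue_measure_itv/= lte_fin.
  case: ltgtP xy => // [xy _|-> _]; first by rewrite -EFinB/= mulrC.
  by rewrite subrr/= mul0r mulr0.
- apply: ae_lebesgueW gd => t + at_ tb e e0 => /(_ at_ tb)[d gtd dc].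
  have [r r0 Hr] := strong_derivative_right gtd e0; exists r => // y ty ytr.
  have yt : 0 < y - t by rewrite subr_gt0.
  rewrite (le_trans (fE _ _))//.
  have -> : g y - g t - (y - t) *: c =
     (y - t) *: (((y - t)^-1 *: (g y - g t) - d) + (d - c)).
    by apply/LfuneqP => s; rewrite !L2_val; field; rewrite gt_eqF.
  rewrite norm2Z gtr0_norm// mulrC ler_pM2r// addrC.
  rewrite (le_trans (norm2D _ _))// lerD// ltW//.
  exact: Hr.
Qed.

(** At [a = 0] the weak derivative may fail to be integrable, and continuity
    of [g] takes over. *)
Lemma mean_value_ineq g c a b (M : R) : (forall T, 0 < T -> W11 T g) ->
  continuous_on_nonneg g -> 0 <= a -> a <= b -> 0 <= M ->
  {ae leb, forall t, a < t -> t < b ->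
     exists2 d, strong_derivative g t d & norm2 (d - c) <= M} ->
  norm2 (g b - g a - (b - a) *: c) <= M * (b - a).
Proof.
move=> Wg cg a0; rewrite le_eqVlt => /predU1P[-> M0 _|ab M0 gd].
  by rewrite !subrr scale0r subrr norm2_0 mulr0.
apply/ler_addgt0Pr => e e0.
have e2 : 0 < e / 2 by rewrite divr_gt0.
have [r r0 Hr] := continuous_on_nonneg_dist cg a0 e2.
have c1 : 0 < 2 * (norm2 c + 1) by rewrite mulr_gt0// ltr_wpDl// norm2_ge0.
pose s := Num.min (Num.min (r / 2) ((b - a) / 2)) (e / (2 * (norm2 c + 1))).
have s0 : 0 < s by rewrite !lt_min !divr_gt0// subr_gt0.
have sr : s < r.
  by rewrite /s !gt_min; apply/orP; left; apply/orP; left; lra.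
have sba : s <= (b - a) / 2 by rewrite /s !ge_min lexx orbT.
have sc : s * norm2 c <= e / 2.
  have : s <= e / (2 * (norm2 c + 1)) by rewrite /s !ge_min lexx !orbT.
  rewrite ler_pdivlMr// => H.
  have : 0 <= s by exact: ltW.
  have := norm2_ge0 c; lra.
have as0 : 0 < a + s by lra.
have b0 : 0 < b + 1 by lra.
have := @mean_value_pos (b + 1) g c (a + s) b M (Wg _ b0) cg as0 (ltac:(lra))
  (ltac:(lra)) M0 (ltac:(apply: ae_lebesgueW gd => t H h1 h2; apply: H; lra)).
have : norm2 (g (a + s) - g a) <= e / 2.
  by apply/ltW/Hr; [exact: ltW|rewrite addrAC subrr add0r ger0_norm// ltW].
have -> : g b - g a - (b - a) *: c =
    (g b - g (a + s) - (b - (a + s)) *: c) + ((g (a + s) - g a) - s *: c).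
  by apply/LfuneqP => x; rewrite !L2_val; ring.
move=> H1 H2.
rewrite (le_trans (norm2D _ _))//.
have := norm2D (g (a + s) - g a) (- (s *: c)).
rewrite norm2N norm2Z ger0_norm ?(ltW s0)// => H3.
have : M * (b - (a + s)) <= M * (b - a) by rewrite ler_wpM2l//; lra.
lra.
Qed.

Variables (A : L2 R -> L2 R) (K C : R).
Hypothesis K0 : 0 <= K.
Hypothesis C0 : 0 <= C.
Hypothesis A_bounded : forall u, norm2 (A u) <= K.
Hypothesis A_lipschitz : forall u v, norm2 (A u - A v) <= C * norm2 (u - v).

Variable g : R -> L2 R.
Hypothesis gW : forall T, 0 < T -> W11 T g.
Hypothesis gC : continuous_on_nonneg g.
Hypothesis gA : {ae leb, forall t, 0 < t ->
  exists2 d, strong_derivative g t d & norm2 (d - A (g t)) = 0}.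

Lemma flow_lipschitz a b : 0 <= a -> a <= b -> norm2 (g b - g a) <= K * (b - a).
Proof.
move=> a0 ab; rewrite -[g b - g a]subr0 -(scaler0 _ (b - a)).
apply: mean_value_ineq => //; apply: ae_lebesgueW gA => t + at_ _.
move=> /(_ (le_lt_trans a0 at_))[d gd dA]; exists d => //.
by rewrite (le_trans (norm2_triangle (A (g t)) _ _))// dA add0r subr0.
Qed.

(** The consistency error of one explicit Euler step: between [a] and [b] the
    velocity moves away from [A (g a)] by at most [C K (b - a)]. *)
Lemma flow_taylor a b : 0 <= a -> a <= b ->
  norm2 (g b - g a - (b - a) *: A (g a)) <= C * K * (b - a) ^+ 2.
Proof.
move=> a0 ab; rewrite expr2 mulrA.
apply: mean_value_ineq => //; first by rewrite !mulr_ge0// subr_ge0.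
apply: ae_lebesgueW gA => t + at_ tb.
move=> /(_ (le_lt_trans a0 at_))[d gd dA]; exists d => //.
rewrite (le_trans (norm2_triangle (A (g t)) _ _))// dA add0r.
rewrite (le_trans (A_lipschitz _ _))// -mulrA ler_wpM2l//.
by rewrite (le_trans (flow_lipschitz a0 (ltW at_)))// ler_wpM2l// lerB// ltW.
Qed.

Fixpoint euler (tau : R) (u : L2 R) (n : nat) : L2 R :=
  if n is n'.+1 then euler tau u n' + tau *: A (euler tau u n') else u.

Lemma eulerS tau u n s : euler tau u n.+1 s =
  euler tau u n s + tau * A (euler tau u n) s.
Proof. by []. Qed.

(** Each step adds the consistency error and multiplies the accumulated one by
    at most [1 + C tau]. *)
Lemma euler_error_aux (tau : R) n : 0 <= tau ->
  norm2 (euler tau (g 0) n - g (n%:R * tau)) <=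
  n%:R * (C * K * tau ^+ 2) * (1 + C * tau) ^+ n.
Proof.
move=> tau0; elim: n => [|n IH].
  by rewrite mul0r subrr norm2_0 !mul0r.
have t0 : 0 <= n%:R * tau by rewrite mulr_ge0.
have nt : n%:R * tau <= n.+1%:R * tau by rewrite ler_wpM2r// ler_nat.
have := flow_taylor t0 nt.
have -> : n.+1%:R * tau - n%:R * tau = tau by rewrite -(natr1 n); ring.
set u := euler tau _ n in IH *; set x := g (n%:R * tau) in IH *.
set y := g (n.+1%:R * tau) => H.
rewrite /= -/u.
have -> : u + tau *: A u - y = (u - x) + tau *: (A u - A x) - (y - x - tau *: A x).
  by apply/LfuneqP => s; rewrite !L2_val; ring.
rewrite (le_trans (norm2D _ _))// norm2N.
have H1 : norm2 (u - x + tau *: (A u - A x)) <= (1 + C * tau) * norm2 (u - x).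
  rewrite (le_trans (norm2D _ _))// mulrDl mul1r lerD2l norm2Z ger0_norm//.
  by rewrite -mulrA mulrCA ler_wpM2l.
have p1 : 1 <= (1 + C * tau) ^+ n.+1.
  by rewrite exprn_ege1// lerDl mulr_ge0.
have H2 : (1 + C * tau) * norm2 (u - x) <=
    (1 + C * tau) * (n%:R * (C * K * tau ^+ 2) * (1 + C * tau) ^+ n).
  by rewrite ler_wpM2l// addr_ge0// mulr_ge0.
have H3 : C * K * tau ^+ 2 <= C * K * tau ^+ 2 * (1 + C * tau) ^+ n.+1.
  by rewrite ler_peMr// !mulr_ge0// sqr_ge0.
rewrite -(natr1 n) mulrDl mul1r mulrDl.
have E : (1 + C * tau) * (n%:R * (C * K * tau ^+ 2) * (1 + C * tau) ^+ n) =
  n%:R * (C * K * tau ^+ 2) * (1 + C * tau) ^+ n.+1 by rewrite (exprS (1 + C * tau)); ring.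
rewrite E in H2; lra.
Qed.

(** Since [(1 + C t / N) ^ N <= exp (C t)], the [N] consistency errors, each of
    order [1 / N ^ 2], add up to an error of order [1 / N]. *)
Lemma euler_error t n : 0 <= t ->
  norm2 (euler (t / n.+1%:R) (g 0) n.+1 - g t) <=
  C * K * t ^+ 2 * expR (C * t) / n.+1%:R.
Proof.
move=> t0; have n0 : 0 < n.+1%:R :> R by rewrite ltr0n.
have tau0 : 0 <= t / n.+1%:R by rewrite divr_ge0// ltW.
have := euler_error_aux n.+1 tau0.
have -> : n.+1%:R * (t / n.+1%:R) = t by field; rewrite addrC natr1 gt_eqF.
move=> /le_trans; apply.
have -> : n.+1%:R * (C * K * (t / n.+1%:R) ^+ 2) * (1 + C * (t / n.+1%:R)) ^+ n.+1 =
   (C * K * t ^+ 2 / n.+1%:R) * (1 + C * (t / n.+1%:R)) ^+ n.+1.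
  by field; rewrite addrC natr1 gt_eqF.
rewrite [leRHS]mulrAC ler_wpM2l ?divr_ge0 ?mulr_ge0 ?sqr_ge0//.
have -> : expR (C * t) = expR (C * (t / n.+1%:R)) ^+ n.+1.
  by rewrite -expRM_natl; congr expR; field; rewrite addrC natr1 gt_eqF.
rewrite lerXn2r ?nnegrE ?expR_ge0 ?addr_ge0 ?mulr_ge0// expR_ge1Dx//.
Qed.

End Lipschitz_flow.

(** * Distribution functions and quantile functions *)

Section quantile_function.
Context {R : realType} (nu : probability (measurableTypeR R) R).
Local Notation leb := (@lebesgue_measure R).
Local Notation Lam := (@Lambda01 R).
Local Notation Q := (quantile nu).
Local Notation C := (Rplus nu).
Implicit Types s t x y : R.

Lemma Rplus_ge0 x : 0 <= C x.
Proof. exact: fine_ge0. Qed.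

Lemma Rplus_le1 x : C x <= 1.
Proof.
rewrite -lee_fin /Rplus fineK ?fin_num_measure//.
exact: probability_le1.
Qed.

Lemma Rplus_nd x y : x <= y -> C x <= C y.
Proof.
move=> xy; rewrite fine_le ?fin_num_measure//; apply: le_measure; rewrite ?inE//.
exact: subset_itvl.
Qed.

Let idTR : measurableTypeR R -> R := idfun.

#[local] HB.instance Definition _ :=
  @isMeasurableFun.Build _ _ _ _ idTR (@measurable_id _ _ setT).

Let RplusE : C = fun x => fine (cdf (idTR : {RV nu >-> R}) x).
Proof. by []. Qed.

Lemma Rplus_y1 : C x @[x --> +oo] --> (1 : R).
Proof. by rewrite RplusE; exact/fine_cvg/cvg_cdfy1. Qed.

Lemma Rplus_Ny0 : C x @[x --> -oo] --> (0 : R).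
Proof. by rewrite RplusE; exact/fine_cvg/cvg_cdfNy0. Qed.

Lemma Rplus_rc x : C y @[y --> x^'+] --> C x.
Proof.
rewrite RplusE; apply: fine_cvg.
by rewrite fineK ?fin_num_measure//; exact: cdf_right_continuous.
Qed.

Lemma quantile_set_neq0 s : s < 1 -> [set x | s <= C x] !=set0.
Proof.
move=> s1; have := Rplus_y1 => /cvgrPdist_lt /(_ (1 - s)).
rewrite subr_gt0 => /(_ s1) [x [xr H]].
exists (x + 1) => /=.
have := H (x + 1) (ltac:(by rewrite ltrDl)).
rewrite ger0_norm ?subr_ge0 ?Rplus_le1//; lra.
Qed.

Lemma quantile_set_lbound s : 0 < s -> has_lbound [set x | s <= C x].
Proof.
move=> s0; have := Rplus_Ny0 => /cvgrPdist_lt /(_ s s0) [x [xr H]].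
exists (x - 1) => y /= sy; rewrite leNgt; apply/negP => yx.
have := H (x - 1) (ltac:(by rewrite ltrBlDr ltrDl)).
rewrite sub0r normrN ger0_norm ?Rplus_ge0//.
have := Rplus_nd (ltW yx); lra.
Qed.

(** The Galois connection between a distribution function and its quantile
    function, by right continuity. *)
Lemma quantile_le s x : s \in `]0, 1[ -> (Q s <= x) = (s <= C x).
Proof.
rewrite in_itv/= => /andP[s0 s1].
have lb := quantile_set_lbound s0; have n0 := quantile_set_neq0 s1.
apply/idP/idP => [Qx|sx]; last exact: (ge_inf lb).
apply: (le_trans _ (Rplus_nd Qx)).
(* right continuity puts the infimum itself in the set *)
apply/ler_addgt0Pl => e e0.
have /cvgrPdist_lt /(_ e e0) := @Rplus_rc (Q s).
rewrite /prop_near1 /at_right /within/= => /nbhs_ballP[d/= d0 H].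
have [y /= sy yd] := inf_adherent (E := [set x | s <= C x]) d0 (conj n0 lb).
have Qy : Q s <= y by exact: (ge_inf lb).
move: Qy; rewrite le_eqVlt => /predU1P[->|Qy]; first by lra.
have := H y; rewrite /ball/= ltr0_norm ?subr_lt0// => /(_ _ Qy).
rewrite opprB ltrBlDl => /(_ yd).
rewrite ltr_norml => /andP[]; lra.
Qed.

Lemma quantile_nd : {in `]0, 1[ &, {homo Q : x y / x <= y}}.
Proof.
move=> s t sI tI st; rewrite quantile_le// (le_trans st)//.
by rewrite -quantile_le.
Qed.

Lemma Lambda01_ray r : 0 <= r -> r <= 1 -> Lam [set` `]-oo, r]] = r%:E.
Proof.
move=> r0; rewrite /Lambda01/= /mrestr le_eqVlt => /predU1P[->|r1].
  rewrite (_ : _ `&` _ = `]0, 1[%classic).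
    by rewrite lebesgue_measure_itv/= lte_fin ltr01 -EFinB subr0.
  by apply/seteqP; split => x /=; rewrite !in_itv/=; lra.
rewrite (_ : _ `&` _ = `]0, r]%classic).
  rewrite lebesgue_measure_itv/= lte_fin.
  by move: r0; rewrite le_eqVlt => /predU1P[<-|r0]; rewrite ?ltxx// r0 -EFinB subr0.
by apply/seteqP; split => x /=; rewrite !in_itv/=; lra.
Qed.

(** Outside of [(0, 1]] the defining set of the infimum is the whole line or
    empty, so the quantile function is constant on each side. *)
Lemma quantile_measurable : measurable_fun setT Q.
Proof.
have m01 : measurable (`]0, 1[ : set R)%classic by exact: measurable_itv.
rewrite (_ : setT = `]0, 1[%classic `|` ([set 1] `|` (`]-oo, 0] `|` `]1, +oo[))); last first.
  apply/seteqP; split => // x _ /=; rewrite !in_itv/=.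
  have [x0|x0] := leP x 0; first by right; right; left.
  have [x1|x1|x1] := ltgtP x 1; [by left|by right; right; right|by right; left].
apply/measurable_funU => //; first by do 2 (apply: measurableU => //).
split.
  apply: (measurability (@RGenCInfty.G R)) => [|/= _ [_] [r] -> <-].
    exact: RGenCInfty.measurableE.
  apply: is_interval_measurable => s t/= [sI rs] [tI rt] u /andP[su ut].
  move: sI tI rs rt; rewrite /= !in_itv/= !andbT => sI tI rs rt.
  have uI : 0 < u < 1 by lra.
  split => //; apply: (le_trans rs); apply: quantile_nd => //; rewrite in_itv//=.
apply/measurable_funU => //; first exact: measurableU.
split; first exact: measurable_fun_set1.
apply/measurable_funU => //; split.
- apply: (eq_measurable_fun (cst (inf setT))) => // s; rewrite inE/= in_itv/= => s0.
  congr inf; apply/seteqP; split => // x _ /=.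
  by rewrite (le_trans s0)// Rplus_ge0.
- apply: (eq_measurable_fun (cst (inf set0))) => // s; rewrite inE/= in_itv/= andbT => s1.
  congr inf; apply/seteqP; split => // x /=.
  by rewrite leNgt (le_lt_trans (Rplus_le1 x)).
Qed.

Lemma Lambda01_quantile x : Lam [set s | Q s <= x] = nu [set` `]-oo, x]].
Proof.
have -> : nu [set` `]-oo, x]] = (C x)%:E by rewrite /Rplus fineK ?fin_num_measure.
rewrite -(Lambda01_ray (Rplus_ge0 x) (Rplus_le1 x)) /Lambda01/= /mrestr.
congr (leb _); apply/seteqP; split => s /= [H sI]; split => //.
- by rewrite in_itv/= -quantile_le.
- by rewrite quantile_le//; move: H; rewrite in_itv.
Qed.

(** By the Galois connection both measures agree on half-lines. *)
Lemma quantile_pushforward (A : set (measurableTypeR R)) : measurable A ->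
  Lam (Q @^-1` A) = nu A.
Proof.
move=> mA.
pose mQ : {mfun measurableTypeR R >-> measurableTypeR R} :=
  HB.pack Q (isMeasurableFun.Build _ _ (measurableTypeR R) (measurableTypeR R) Q quantile_measurable).
rewrite -(lebesgue_stieltjes_cdf_id nu mA).
apply/esym; apply: (lebesgue_stieltjes_measure_unique (mu := pushforward Lam mQ)) => //.
move=> X [[a b]/= _ <-].
rewrite lebesgue_stieltjes_cdf_id; last exact: measurable_itv.
rewrite /pushforward/=.
have [ab|ba] := leP a b; last first.
  by rewrite set_itv_ge ?preimage_set0 ?measure0// bnd_simp -leNgt ltW.
have E : `]a, b]%classic = `]-oo, b] `\` `]-oo, a] => [|].
  by rewrite -[RHS]setCK setCD setCitvl setUC -[LHS]setCK setCitv.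
rewrite E -[Q @^-1` _]/(Q @^-1` `]-oo, b] `\` Q @^-1` `]-oo, a]).
have sab : `]-oo, a]%classic `<=` `]-oo, b] by exact: subset_itvl.
have nuf x : (nu [set` `]-oo, x]] < +oo)%E by rewrite (le_lt_trans (probability_le1 _ _)) ?ltry.
have mray (x : R) : measurable (Q @^-1` [set` `]-oo, x]] : set (measurableTypeR R)).
  by rewrite -[X in measurable X]setTI; apply: quantile_measurable.
rewrite (@measureD _ _ _ nu)//; last exact: nuf.
rewrite [RHS](@measureD _ _ _ Lam); [|exact: mray|exact: mray|exact: (Lambda01_lty (mray b))].
rewrite setIidr// setIidr; last exact: preimage_subset.
have nuQ x : nu [set` `]-oo, x]] = Lam (Q @^-1` [set` `]-oo, x]]).
  rewrite -Lambda01_quantile; apply: (congr1 Lam).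
  by apply/seteqP; split => s /=; rewrite in_itv.
by congr (_ - _)%E; [exact: nuQ|exact: nuQ].
Qed.

(** The integral of [|Q|] is the first absolute moment of [nu], and
    [|x| <= 1 + x^2]. *)
Lemma quantile_integrable : finite_second_moment nu ->
  Lam.-integrable setT (EFin \o Q).
Proof.
move=> nu2; apply/integrableP; split; first by apply/measurable_EFinP; exact: quantile_measurable.
pose mQ : {mfun measurableTypeR R >-> measurableTypeR R} :=
  HB.pack Q (isMeasurableFun.Build _ _ (measurableTypeR R) (measurableTypeR R) Q quantile_measurable).
have -> : (\int[Lam]_s `|(EFin \o Q) s| = \int[pushforward Lam mQ]_x `|x%:E|)%E.
  rewrite (@ge0_integral_pushforward _ _ _ _ R mQ)//.
  exact: measurableT_comp.
have -> : (\int[pushforward Lam mQ]_x `|x%:E| = \int[nu]_x `|x%:E|)%E.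
  by apply: eq_measure_integral => A mA _; exact: quantile_pushforward.
apply: (@le_lt_trans _ _ (\int[nu]_x (1 + (x ^+ 2)%:E))%E).
  apply: ge0_le_integral => //.
  - exact: measurableT_comp.
  - apply: emeasurable_funD => //; exact/measurable_EFinP/measurable_funX.
  - move=> x _; rewrite -EFinD lee_fin -[x ^+ 2]real_normK ?num_real//.
    have := sqr_ge0 (`|x| - 1); have := normr_ge0 x; nra.
have m2 : measurable_fun setT (fun x : measurableTypeR R => (x ^+ 2)%:E).
  exact/measurable_EFinP/measurable_funX.
rewrite ge0_integralD//; last by move=> x _; rewrite lee_fin sqr_ge0.
by rewrite integral_cst//= probability_setT mule1 lte_add_pinfty// ltry.
Qed.

End quantile_function.

(** * The gradient of the energy *)

Section integrable_real.
Context d (T : measurableType d) (R : realType) (mu : {measure set T -> \bar R}).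
Variables (D : set T) (mD : measurable D).
Implicit Types f g : T -> R.

Lemma integrableD_EFin f g : mu.-integrable D (EFin \o f) ->
  mu.-integrable D (EFin \o g) -> mu.-integrable D (EFin \o (fun x => f x + g x)).
Proof. by move=> fi gi; exact: (integrableD mD fi gi). Qed.

Lemma integrableB_EFin f g : mu.-integrable D (EFin \o f) ->
  mu.-integrable D (EFin \o g) -> mu.-integrable D (EFin \o (fun x => f x - g x)).
Proof. by move=> fi gi; exact: (integrableB mD fi gi). Qed.

Lemma integrableZl_EFin k f : mu.-integrable D (EFin \o f) ->
  mu.-integrable D (EFin \o (fun x => k * f x)).
Proof. by move=> fi; exact: (integrableZl mD k fi). Qed.

End integrable_real.

Section velocity.
Context {R : realType} (nu : probability (measurableTypeR R) R).
Local Notation leb := (@lebesgue_measure R).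
Local Notation Lam := (@Lambda01 R).
Local Notation Q := (quantile nu).
Local Notation C := (Rplus nu).
Local Notation L := (Llow (quantile nu)).
Implicit Types s t x y : R.
Hypothesis nu2 : finite_second_moment nu.
Hypothesis L0 : 0 < L.

Lemma quantile_lower s1 s2 : s1 \in `]0, 1[ -> s2 \in `]0, 1[ -> s1 <= s2 ->
  L * (s2 - s1) <= Q s2 - Q s1.
Proof.
move=> s1I s2I; rewrite le_eqVlt => /predU1P[->|s12]; first by rewrite !subrr mulr0.
have [[_ H] _] := Llow_max (@quantile_nd _ nu).
rewrite -ler_pdivlMr ?subr_gt0//; apply: H => //.
by rewrite gt_eqF.
Qed.

(** Two levels strictly between [C x] and [C y] have their quantiles in
    [[x, y]], which bounds their distance by [(y - x) / L]. *)
Lemma Rplus_lipschitz_le x y : x <= y -> C y - C x <= (y - x) / L.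
Proof.
move=> xy; rewrite leNgt; apply/negP => H.
have Cx0 := Rplus_ge0 nu x; have Cy1 := Rplus_le1 nu y.
have yx0 : 0 <= (y - x) / L by rewrite divr_ge0 ?subr_ge0// ltW.
(* [e] is a third of the excess, so the levels [C x + e] and [C y - e] are still too far apart *)
pose e := (C y - C x - (y - x) / L) / 3.
have e0 : 0 < e by rewrite divr_gt0// subr_gt0.
have e3 : 3 * e = C y - C x - (y - x) / L by rewrite mulrC divfK.
have s1I : C x + e \in `]0, 1[ by rewrite in_itv/=; apply/andP; split; lra.
have s2I : C y - e \in `]0, 1[ by rewrite in_itv/=; apply/andP; split; lra.
have := quantile_lower s1I s2I (ltac:(lra)).
have Q1 : x <= Q (C x + e).
  by rewrite leNgt; apply/negP => /ltW; rewrite quantile_le// gerDl leNgt e0.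
have Q2 : Q (C y - e) <= y by rewrite quantile_le// gerBl ltW.
have H3 : (y - x) / L < C y - e - (C x + e) by lra.
rewrite ltr_pdivrMr// mulrC in H3; lra.
Qed.

Lemma Rplus_lipschitz x y : `|C y - C x| <= `|y - x| / L.
Proof.
have [xy|/ltW xy] := leP x y.
  by rewrite !ger0_norm ?subr_ge0 ?Rplus_nd// Rplus_lipschitz_le.
by rewrite !ler0_norm ?subr_le0 ?Rplus_nd// !opprB Rplus_lipschitz_le.
Qed.

Lemma Rplus_measurable : measurable_fun setT C.
Proof. by apply: nondecreasing_measurable => // x y; exact: Rplus_nd. Qed.

Lemma ae_bounded_Lfun (f : R -> R) (c : R) : measurable_fun setT f ->
  (forall s, s \in `]0, 1[ -> `|f s| <= c) -> f \in Lfun Lam 2%:E.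
Proof.
move=> mf fc; rewrite inE; apply/andP; split; rewrite inE//= /finite_norm.
rewrite unlock poweR_lty//.
apply: (@le_lt_trans _ _ (\int[Lam]_s (c `^ 2)%:E)%E); last first.
  by rewrite integral_cst// Lambda01_setT mule1 ltry.
have c0 : 0 <= c.
  by rewrite (le_trans (normr_ge0 (f 2^-1)))// fc// in_itv/=; apply/andP; split; lra.
apply: ae_ge0_le_integral => //.
- by move=> s _; rewrite lee_fin powR_ge0.
- apply/measurable_EFinP.
  apply: (@measurableT_comp _ _ _ _ _ _ (fun x : R => x `^ 2)%R) => //.
  exact: measurableT_comp.
- by move=> s _; rewrite lee_fin powR_ge0.
- by apply: ae_Lambda01 => s sI _; rewrite lee_fin ge0_ler_powR// ?nnegrE// fc.
Qed.

Lemma velocity_Lfun (u : L2 R) : (fun s => 2 * (s - C (u s))) \in Lfun Lam 2%:E.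
Proof.
apply: (@ae_bounded_Lfun _ 2).
  apply: measurable_funM => //; apply: measurable_funB => //.
  by apply: measurableT_comp; [exact: Rplus_measurable|exact: L2_measurable].
move=> s; rewrite in_itv/= => /andP[s0 s1].
have := Rplus_ge0 nu (u s); have := Rplus_le1 nu (u s) => ? ?.
by rewrite ler_norml; apply/andP; split; lra.
Qed.

(** The negative gradient of the energy: see [Ffun_smooth]. *)
Definition velocity (u : L2 R) : L2 R := Lfun_Sub (lee1n 2) (velocity_Lfun u).

Lemma velocityE u s : velocity u s = 2 * (s - C (u s)).
Proof. by []. Qed.

Lemma velocity_bounded u : norm2 (velocity u) <= 2.
Proof.
apply: norm2_ae_le => //; apply: ae_Lambda01 => s; rewrite in_itv/= => /andP[s0 s1].
have := Rplus_ge0 nu (u s); have := Rplus_le1 nu (u s) => ? ?.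
change (`|2 * (s - C (u s))| <= 2).
by rewrite ler_norml; apply/andP; split; lra.
Qed.

Lemma velocity_lipschitz u v :
  norm2 (velocity u - velocity v) <= 2 / L * norm2 (u - v).
Proof.
have L20 : 0 <= 2 / L by rewrite divr_ge0// ltW.
rewrite -(ger0_norm L20) -norm2Z.
apply: norm2_le_ae; apply: ae_Lambda01 => s _.
rewrite !L2_val !velocityE normrM (ger0_norm L20).
have -> : 2 * (s - C (u s)) - 2 * (s - C (v s)) = - (2 * (C (u s) - C (v s))) by ring.
rewrite normrN normrM (@ger0_norm _ 2)// -mulrA ler_wpM2l// mulrC.
exact: Rplus_lipschitz.
Qed.

Lemma Lambda01_integrable_cst x : Lam.-integrable setT (EFin \o cst x).
Proof.
apply/integrableP; split; first exact/measurable_EFinP.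
by under eq_integral do rewrite /=; rewrite integral_cst// Lambda01_setT mule1 ltry.
Qed.

Definition dist_quantile x : R := \int[Lam]_t `|x - Q t|.
Local Notation E := dist_quantile.

Lemma dist_quantile_integrable x : Lam.-integrable setT (EFin \o (fun t => `|x - Q t|)).
Proof.
apply: integrable_norm.
apply: integrableB_EFin => //; first exact: Lambda01_integrable_cst.
exact: quantile_integrable.
Qed.

Lemma ae_le_RintegralLam (f g : R -> R) : Lam.-integrable setT (EFin \o f) ->
  Lam.-integrable setT (EFin \o g) -> (forall s, s \in `]0, 1[ -> f s <= g s) ->
  \int[Lam]_s f s <= \int[Lam]_s g s.
Proof.
move=> fi gi fg; rewrite -subr_ge0 -RintegralB//.
have hi : Lam.-integrable setT (EFin \o (fun s => g s - f s)).
  exact: integrableB_EFin.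
suff -> : \int[Lam]_s (g s - f s) = \int[Lam]_s `|g s - f s|.
  exact: Rintegral_ge0.
congr fine; apply: ae_eq_integral => //.
- by have /integrableP[] := hi.
- by have /integrable_norm/integrableP[] := hi.
- by apply: ae_Lambda01 => s sI _; rewrite ger0_norm// subr_ge0 fg.
Qed.

Lemma indic_ray_integrable x : Lam.-integrable setT (EFin \o \1_([set` `]-oo, x]])).
Proof.
apply/integrableP; split; first exact/measurable_EFinP.
under eq_integral => t _ do rewrite /= ger0_norm//.
by rewrite integral_indic// setIT; exact: Lambda01_lty.
Qed.

(** [2 C y - 1] is a subgradient at [y] of the mean distance to [nu]: the
    levels [t <= C y] are those with [Q t <= y], and each contributes slope [1],
    while the others contribute slope [- 1]. *)
Lemma dist_quantile_convex x y : E y - E x <= (2 * C y - 1) * (y - x).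
Proof.
rewrite -RintegralB//; try exact: dist_quantile_integrable.
pose f t := (2 * (y - x)) * \1_([set` `]-oo, C y]]) t - (y - x).
have i1 : Lam.-integrable setT (EFin \o (fun t : R => (2 * (y - x)) * \1_([set` `]-oo, C y]]) t)).
  by apply: integrableZl_EFin => //; exact: indic_ray_integrable.
have i2 := Lambda01_integrable_cst (y - x).
apply: (@le_trans _ _ (\int[Lam]_t f t)).
  apply: ae_le_RintegralLam.
  - by apply: integrableB_EFin => //; exact: dist_quantile_integrable.
  - exact: (integrableB_EFin measurableT i1 i2).
  - move=> t tI; rewrite /f indicE mem_setE in_itv/= -quantile_le//.
    have := ler_norm (x - Q t); have := ler_norm (- (x - Q t)); rewrite normrN.
    have [Qy|/ltW Qy] := leP (Q t) y => /=.
      by rewrite [`|y - _|]ger0_norm ?subr_ge0//; lra.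
    by rewrite [`|y - _|]ler0_norm ?subr_le0//; lra.
rewrite RintegralB// RintegralZl//; last exact: indic_ray_integrable.
rewrite Rintegral_cst// /Rintegral integral_indic// setIT Lambda01_setT.
rewrite Lambda01_ray ?Rplus_ge0 ?Rplus_le1//=; lra.
Qed.

Lemma dist_quantile_lip x y : `|E y - E x| <= `|y - x|.
Proof.
have H a b : E a - E b <= `|a - b|.
  rewrite (le_trans (dist_quantile_convex _ _))// (le_trans (ler_norm _))//.
  rewrite normrM ler_piMl//; have := Rplus_ge0 nu a; have := Rplus_le1 nu a => ? ?.
  by rewrite ler_norml; apply/andP; split; lra.
by rewrite ler_norml H andbT lerNl opprB distrC H.
Qed.

Lemma dist_quantile_measurable : measurable_fun setT E.
Proof.
apply: continuous_measurable_fun => x; apply/cvgrPdist_le => e e0.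
apply/nbhs_ballP; exists e => //= y; rewrite /ball/= => xy.
by rewrite (le_trans (dist_quantile_lip _ _))// ltW.
Qed.

Lemma dist_quantile_comp_integrable (u : L2 R) :
  Lam.-integrable setT (EFin \o (fun s => E (u s))).
Proof.
have i : Lam.-integrable setT (EFin \o (fun s => `|E 0| + `|u s|)).
  apply: integrableD_EFin => //; first exact: Lambda01_integrable_cst.
  by apply: integrable_norm; exact: L2_integrable.
apply: le_integrable i => //.
  apply/measurable_EFinP; apply: measurableT_comp; first exact: dist_quantile_measurable.
  exact: L2_measurable.
move=> s _ /=; rewrite lee_fin [leRHS]ger0_norm ?addr_ge0//.
rewrite -[E (u s)](subrK (E 0)) (le_trans (ler_normD _ _))// addrC lerD2l.
by rewrite (le_trans (dist_quantile_lip _ _))// subr0.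
Qed.

Lemma weight_Lfun : (fun s : R => 1 - 2 * s) \in Lfun Lam 2%:E.
Proof.
apply: (@ae_bounded_Lfun _ 1).
  by apply: measurable_funB => //; apply: measurable_funM.
by move=> s; rewrite in_itv/= => /andP[s0 s1]; rewrite ler_norml; apply/andP; split; lra.
Qed.

Let weight : L2 R := Lfun_Sub (lee1n 2) weight_Lfun.

Lemma FfunE u : Ffun nu u = inner2 weight u + \int[Lam]_s E (u s).
Proof.
rewrite /Ffun RintegralD//; first exact: (L2_mul_integrable weight u).
exact: dist_quantile_comp_integrable.
Qed.

(** [- velocity u] is the gradient of the energy at [u]: the subgradient
    inequality at [u + z] bounds the increment by a slope taken at [u + z], and
    the Lipschitz bound for the distribution function moves this slope back to
    [u] at the cost of a term of second order. *)
Lemma Ffun_smooth u z :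
  Ffun nu (u + z) - Ffun nu u <= - inner2 (velocity u) z + 2 / L * norm2 z ^+ 2.
Proof.
rewrite !FfunE (inner2C weight) inner2Dl !(inner2C _ weight).
suff : \int[Lam]_s E ((u + z) s) - \int[Lam]_s E (u s) <=
    - inner2 (velocity u + weight) z + 2 / L * norm2 z ^+ 2.
  by rewrite inner2Dl; lra.
rewrite -RintegralB//; try exact: dist_quantile_comp_integrable.
rewrite -inner2Nl norm2_sqr -RintegralZl//; last exact: L2_integrable_sqr.
have i2 : Lam.-integrable setT (EFin \o (fun s => 2 / L * z s ^+ 2)).
  by apply: integrableZl_EFin => //; exact: L2_integrable_sqr.
rewrite -RintegralD//; last exact: L2_mul_integrable.
apply: ae_le_RintegralLam.
- by apply: integrableB_EFin => //; exact: dist_quantile_comp_integrable.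
- by apply: integrableD_EFin => //; exact: L2_mul_integrable.
- move=> s sI; rewrite (le_trans (dist_quantile_convex _ _))//.
  rewrite !L2_val velocityE [weight s]/(1 - 2 * s).
  have -> : u s + z s - u s = z s by ring.
  have -> : (- (2 * (s - C (u s)) + (1 - 2 * s))) = 2 * C (u s) - 1 by ring.
  rewrite -lerBlDl -mulrBl.
  have -> : 2 * C (u s + z s) - 1 - (2 * C (u s) - 1) = 2 * (C (u s + z s) - C (u s)) by ring.
  rewrite (le_trans (ler_norm _))// !normrM (@ger0_norm _ 2)// -!mulrA ler_wpM2l//.
  rewrite -[z s ^+ 2]real_normK ?num_real// expr2 mulrA ler_wpM2r//.
  rewrite (le_trans (Rplus_lipschitz _ _))// mulrC.
  by rewrite (_ : u s + z s - u s = z s)//; ring.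
Qed.

(** For [z = v + velocity u], a step [e z] contradicts the first order
    expansion of the energy unless [z] vanishes. *)
Lemma subdifferential_velocity u v : subdifferential (Ffun nu) u v ->
  norm2 (v + velocity u) = 0.
Proof.
move=> sub; set z := v + velocity u.
apply/eqP; rewrite eq_le norm2_ge0 andbT leNgt; apply/negP => z0.
have [d d0 H] := sub (norm2 z / 4) (divr_gt0 z0 (ltr0n _ 4)).
(* the second bound keeps the quadratic term [2 / L * (e * |z|)^2] below [e * |z|^2 / 4] *)
pose e := Num.min (d / (2 * norm2 z)) (L / 8).
have e0 : 0 < e by rewrite lt_min !divr_gt0// mulr_gt0.
have ed : e * norm2 z < d.
  have : e <= d / (2 * norm2 z) by rewrite ge_min lexx.
  by rewrite ler_pdivlMr ?mulr_gt0//; lra.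
have eL : 2 / L * e <= 1 / 4.
  have : e <= L / 8 by rewrite ge_min lexx orbT.
  move=> h; rewrite mulrAC ler_pdivrMr//; lra.
have uz : u + e *: z - u = e *: z by rewrite addrAC subrr add0r.
have := H (u + e *: z); rewrite uz norm2Z (gtr0_norm e0) => /(_ ed).
have := Ffun_smooth u (e *: z).
rewrite norm2Z (gtr0_norm e0) !inner2Zr.
have zz : norm2 z ^+ 2 = inner2 v z + inner2 (velocity u) z.
  by rewrite -inner2uu -inner2Dl.
move=> h1 h2.
have : e * norm2 z ^+ 2 <= e * (norm2 z ^+ 2 / 4) + (2 / L * e) * (e * norm2 z ^+ 2).
  have : e * norm2 z ^+ 2 = e * inner2 v z + e * inner2 (velocity u) z.
    by rewrite zz mulrDr.
  lra.
have zp : 0 < e * norm2 z ^+ 2 by rewrite mulr_gt0// exprn_gt0.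
have : (2 / L * e) * (e * norm2 z ^+ 2) <= 1 / 4 * (e * norm2 z ^+ 2).
  by rewrite ler_wpM2r// ltW.
lra.
Qed.

End velocity.

(** * Lower Lipschitz bounds along Euler polygons *)

Section euler_monotone.
Context {R : realType} (nu : probability (measurableTypeR R) R).
Local Notation Lam := (@Lambda01 R).
Local Notation C := (Rplus nu).
Local Notation L := (Llow (quantile nu)).
Implicit Types (s t x y : R) (u : L2 R).
Hypothesis L0 : 0 < L.

(** The convex combination of the lower Lipschitz constants [b] and [L] in which
    [b] has weight [x]. *)
Definition Llow_mix (b x : R) : R := b * x + L * (1 - x).

(** If two values differ by [d >= 0], then after one step they differ by at least
    [(1 - 2 tau / L) d + 2 tau (s2 - s1)]; the constant [L] is the fixed point of
    the induced recursion on lower Lipschitz constants. *)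
Lemma euler_lower_lipschitz (b tau s1 s2 : R) u n :
  0 <= b -> 0 <= tau -> 2 * tau <= L -> s1 <= s2 -> b * (s2 - s1) <= u s2 - u s1 ->
  Llow_mix b ((1 - 2 * tau / L) ^+ n) * (s2 - s1) <=
  euler (velocity nu) tau u n s2 - euler (velocity nu) tau u n s1.
Proof.
move=> b0 tau0 tauL s12 us.
have r0 : 0 <= 1 - 2 * tau / L by rewrite subr_ge0 ler_pdivrMr// mul1r.
have r1 : 1 - 2 * tau / L <= 1 by rewrite gerBl divr_ge0 ?mulr_ge0 ?(ltW L0).
set r := 1 - 2 * tau / L in r0 r1 *.
elim: n => [|n IH]; first by rewrite /Llow_mix expr0 mulr1 subrr mulr0 addr0.
have rn0 : 0 <= r ^+ n by rewrite exprn_ge0.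
have rn1 : r ^+ n <= 1 by rewrite exprn_ile1.
rewrite (eulerS _ tau u n s1) (eulerS _ tau u n s2).
rewrite !velocityE.
set x1 := euler _ _ _ n s1 in IH *; set x2 := euler _ _ _ n s2 in IH *.
have bn0 : 0 <= Llow_mix b (r ^+ n).
  by rewrite /Llow_mix addr_ge0 ?mulr_ge0 ?(ltW L0)// subr_ge0.
have ds : 0 <= s2 - s1 by rewrite subr_ge0.
have dx : 0 <= x2 - x1 by rewrite (le_trans _ IH)// mulr_ge0.
have dC : C x2 - C x1 <= (x2 - x1) / L by apply: Rplus_lipschitz_le => //; rewrite -subr_ge0.
have H1 : tau * (C x2 - C x1) <= tau * ((x2 - x1) / L) by rewrite ler_wpM2l.
have H2 : r * (Llow_mix b (r ^+ n) * (s2 - s1)) <= r * (x2 - x1) by rewrite ler_wpM2l.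
have E : Llow_mix b (r ^+ n.+1) = r * Llow_mix b (r ^+ n) + 2 * tau.
  have -> : 2 * tau = L * (1 - r) by rewrite /r; field; rewrite gt_eqF.
  by rewrite /Llow_mix exprS; ring.
have E2 : r * (x2 - x1) = (x2 - x1) - 2 * (tau * ((x2 - x1) / L)) by rewrite /r; ring.
rewrite E; lra.
Qed.

End euler_monotone.

Section limits.
Context {R : realType}.
Local Notation Lam := (@Lambda01 R).

(** From above by [1 - y <= exp (- y)], and from below by
    [1 - y >= exp (- y / (1 - y))], both instances of [1 + z <= exp z]. *)
Lemma cvg_exp_compound (x : R) : 0 <= x ->
  (1 - x / n.+1%:R) ^+ n.+1 @[n --> \oo] --> expR (- x).
Proof.
move=> x0.
have hn : (fun n => x / n.+1%:R) @ \oo --> (0 : R).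
  by rewrite -(mulr0 x); apply: cvgM; [exact: cvg_cst|exact: cvg_harmonic].
have h1 : (fun n => 1 - x / n.+1%:R) @ \oo --> (1 : R).
  by rewrite -[X in _ --> X]subr0; apply: cvgB => //; exact: cvg_cst.
apply: (@squeeze_cvgr _ _ _ _ (fun n => expR (- (x / (1 - x / n.+1%:R)))) (cst (expR (- x)))).
- have /cvgrPdist_lt /(_ 1 ltr01) [N _ HN] := hn.
  exists N => // n Nn /=.
  have n0 : 0 < n.+1%:R :> R by rewrite ltr0n.
  have y0 : 0 <= x / n.+1%:R by rewrite divr_ge0// ltW.
  have y1 : x / n.+1%:R < 1 by have := HN n Nn; rewrite sub0r normrN ger0_norm.
  have y1' : 0 < 1 - x / n.+1%:R by rewrite subr_gt0.
  have nx : n.+1%:R * (x / n.+1%:R) = x by rewrite mulrC divfK ?gt_eqF.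
  apply/andP; split.
  + have -> : - (x / (1 - x / n.+1%:R)) =
       n.+1%:R * (- ((x / n.+1%:R) / (1 - x / n.+1%:R))) by rewrite mulrN mulrA nx.
    rewrite expRM_natl lerXn2r ?nnegrE ?expR_ge0 ?(ltW y1')// expRN.
    rewrite -[leRHS]invrK lef_pV2 ?posrE ?expR_gt0 ?invr_gt0//.
    apply: le_trans (expR_ge1Dx _).
    rewrite le_eqVlt; apply/orP; left; apply/eqP; field.
    by rewrite addrC natr1 gt_eqF//= subr_eq0 eq_sym; move: y1; rewrite ltr_pdivrMr// mul1r => /lt_eqF ->.
  + have -> : expR (- x) = expR (- (x / n.+1%:R)) ^+ n.+1.
      by rewrite -expRM_natl mulrN nx.
    by rewrite lerXn2r ?nnegrE ?expR_ge0 ?(ltW y1')// expR_ge1Dx.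
- apply: (cvg_comp _ expR); last exact: continuous_expR.
  apply: cvgN; rewrite -[X in _ --> X]divr1; apply: cvgM; first exact: cvg_cst.
  by apply: cvgV => //; exact: oner_neq0.
- exact: cvg_cst.
Qed.

(** A rapidly convergent subsequence makes the squared distances summable
    almost everywhere. *)
Lemma norm2_cvg_ae (V : nat -> L2 R) (u : L2 R) :
  norm2 (V n - u) @[n --> \oo] --> (0 : R) -> exists phi : nat -> nat,
  (forall k, (k <= phi k)%N) /\ {ae Lam, forall s, V (phi k) s @[k --> \oo] --> u s}.
Proof.
move=> /cvgrPdist_lt cV.
have ex k : exists n, (k <= n)%N /\ norm2 (V n - u) ^+ 2 <= 1 / (2 ^ k.+1)%:R.
  have p0 : 0 < 1 / (2 ^ k.+1)%:R :> R by rewrite divr_gt0// ltr0n expn_gt0.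
  have p1 : 1 / (2 ^ k.+1)%:R <= 1 :> R.
    by rewrite ler_pdivrMr ?ltr0n ?expn_gt0// mul1r ler1n expn_gt0.
  have [N _ H] := cV _ p0; exists (maxn N k); split; first exact: leq_maxr.
  have := H (maxn N k) (leq_maxl _ _); rewrite /= sub0r normrN ger0_norm ?norm2_ge0// => h.
  by rewrite expr2 (le_trans _ (ltW h))// ler_piMr ?norm2_ge0// (le_trans (ltW h)).
have [phi Hphi] := choice ex.
exists phi; split; first by move=> k; have [] := Hphi k.
pose f k s := (((V (phi k) - u) s) ^+ 2)%:E.
have mf k : measurable_fun setT (f k).
  by have /integrableP[] := L2_integrable_sqr (V (phi k) - u).
have f0 k s : (0 <= f k s)%E by rewrite lee_fin sqr_ge0.
have mF : measurable_fun setT (fun s => \sum_(k <oo) f k s)%E.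
  by apply: ge0_emeasurable_sum.
have F0 s : (0 <= \sum_(k <oo) f k s)%E by exact: nneseries_ge0.
have iF : Lam.-integrable setT (fun s => \sum_(k <oo) f k s)%E.
  apply/integrableP; split => //.
  under eq_integral => s _ do rewrite gee0_abs//.
  rewrite integral_nneseries//.
  apply: (@le_lt_trans _ _ (\sum_(k <oo) (1 / (2 ^ k.+1)%:R)%:E)%E).
    apply: lee_nneseries; first by move=> k _ _; exact: integral_ge0.
    move=> k _; have [_] := Hphi k; rewrite norm2_sqr -lee_fin /Rintegral fineK//.
    by apply: integrable_fin_num => //; exact: L2_integrable_sqr.
  by rewrite (le_lt_trans (epsilon_trick0 _ ler01))// ltry.
have := integrable_ae measurableT iF; apply: filterS => s /(_ I).
rewrite ge0_fin_numE// => Flt.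
have /fine_cvgP[[N0 _ finT] /cvgrPdist_lt cT] := @nneseries_tail_cvg _ _ predT Flt (fun k _ => f0 k s).
apply/cvgrPdist_lt => e e0.
have [N1 _ HT] := cT _ (exprn_gt0 2 e0).
exists (maxn N0 N1) => // k; rewrite /= geq_max => /andP[k0 k1].
have := HT k k1; rewrite /= sub0r normrN.
have tail0 : (0 <= \sum_(k <= i <oo) f i s)%E by exact: nneseries_ge0.
rewrite ger0_norm ?fine_ge0// => H.
have fk : (V (phi k) s - u s) ^+ 2 < e ^+ 2.
  apply: le_lt_trans H; rewrite -lee_fin fineK; last exact: finT.
  have := @nneseries_lim_ge _ (f ^~ s) predT k k.+1 (fun n _ _ => f0 n s).
  by rewrite big_nat1.
rewrite distrC -ltr_sqr ?nnegrE ?(ltW e0)//.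
by rewrite real_normK// num_real.
Qed.

End limits.

(** * Left-continuous representatives and push-forwards *)

Section representative.
Context {R : realType}.
Local Notation leb := (@lebesgue_measure R).
Local Notation Lam := (@Lambda01 R).
Implicit Types (s t x y a b B : R) (u q : R -> R) (D : set R).

Definition lower_lipschitz_on D B u := forall s1 s2, D s1 -> D s2 -> s1 <= s2 ->
  B * (s2 - s1) <= u s2 - u s1.

Lemma ae_Lambda01_dense D a b : {ae Lam, forall s, D s} ->
  0 <= a -> a < b -> b <= 1 -> exists2 r, D r & a < r < b.
Proof.
move=> [N [mN N0 DN]] a0 ab b1; apply: contrapT => noD.
have sub : `]a, b[%classic `<=` N.
  move=> r; rewrite /= in_itv/= => arb; apply: DN => /= Dr.
  by apply: noD; exists r.
have : (Lam `]a, b[%classic <= Lam N)%E by apply: le_measure; rewrite ?inE.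
rewrite N0 /Lambda01/= /mrestr setIidl; last first.
  by move=> r /=; rewrite !in_itv/=; lra.
by rewrite lebesgue_measure_itv/= lte_fin ab -EFinB lee_fin subr_le0 leNgt ab.
Qed.

Lemma ae_Lambda01_and (P Q S : R -> Prop) : (forall s, P s -> Q s -> S s) ->
  {ae Lam, forall s, P s} -> {ae Lam, forall s, Q s} -> {ae Lam, forall s, S s}.
Proof.
move=> PQS; exact: (@filterS2 _ _ (ae_filter_ringOfSetsType Lam) _ _ _ PQS).
Qed.

Lemma ae_Lambda01_in D : {ae Lam, forall s, D s} ->
  {ae Lam, forall s, D s /\ s \in `]0, 1[}.
Proof.
move=> aeD; have : {ae Lam, forall s, s \in `]0, 1[} by exact: ae_Lambda01.
by move=> aeI; apply: (ae_Lambda01_and _ aeD aeI) => s.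
Qed.

Lemma Lambda01_countable_negligible (E : set R) : countable E ->
  {ae Lam, forall s, ~ E s}.
Proof.
move=> cE; exists E; split.
- by apply: countable_measurable.
- rewrite /Lambda01/= /mrestr countable_lebesgue_measure0//.
  exact: (sub_countable (subset_card_le (@subIsetl _ _ _))).
- by move=> s /= /contrapT.
Qed.

(** The left-continuous representative is the supremum of the values to the
    left; it differs from [u] only at jumps, and there are countably many of
    these because the jump intervals are disjoint. *)
Lemma left_continuous_repr_exists (u : L2 R) D : {ae Lam, forall s, D s} ->
  (forall s1 s2, D s1 -> D s2 -> s1 <= s2 -> u s1 <= u s2) ->
  exists q, left_continuous_repr u q.
Proof.
move=> /ae_Lambda01_in aeD' und.
pose D' s := D s /\ s \in `]0, 1[.
have D'01 r : D' r -> 0 < r < 1 by move=> [_]; rewrite in_itv.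
pose V s := [set x | exists r, [/\ D' r, r < s & x = u r]].
pose q s := sup (V s).
have dense a b : 0 <= a -> a < b -> b <= 1 -> exists2 r, D' r & a < r < b.
  exact: ae_Lambda01_dense.
have ubV s r : D' r -> s <= r -> ubound (V s) (u r).
  move=> [Dr _] sr x [r' [[Dr' _] r's ->]].
  by apply: und => //; rewrite (le_trans (ltW r's)).
have hV s : 0 < s -> s < 1 -> has_sup (V s).
  move=> s0 s1; split.
    have [r Dr /andP[_ rs]] := dense 0 s (lexx _) s0 (ltW s1).
    by exists (u r), r.
  have [r Dr /andP[sr _]] := dense s 1 (ltW s0) s1 (lexx _).
  by exists (u r); apply: ubV => //; exact: ltW.
have qge s r : 0 < s -> s < 1 -> D' r -> r < s -> u r <= q s.
  by move=> s0 s1 Dr rs; apply: ub_le_sup; [exact: (hV _ s0 s1).2|exists r].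
have qle s r : 0 < s -> s < 1 -> D' r -> s <= r -> q s <= u r.
  by move=> s0 s1 Dr sr; apply: ge_sup; [exact: (hV _ s0 s1).1|exact: ubV].
have qnd : {in `]0, 1[ &, {homo q : x y / x <= y}}.
  move=> s s'; rewrite !in_itv/= => /andP[s0 s1] /andP[s'0 s'1] ss'.
  apply: ge_sup; first exact: (hV _ s0 s1).1.
  by move=> x [r [Dr rs ->]]; apply: qge => //; exact: lt_le_trans ss'.
exists q; split => //.
- move=> s sI; have := sI; rewrite in_itv/= => /andP[s0 s1].
  apply/cvgrPdist_lt => e e0.
  have [x [r [Dr rs ->]] qx] := sup_adherent e0 (hV s s0 s1).
  have /andP[r0 r1] := D'01 _ Dr.
  exists (s - r) => /=; first by rewrite subr_gt0.
  move=> y; rewrite /ball/= => ysr ys.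
  have ry : r < y by move: ysr; rewrite gtr0_norm ?subr_gt0//; lra.
  have y0 : 0 < y by exact: lt_trans ry.
  have y1 : y < 1 by exact: lt_trans s1.
  have h1 := qge y r y0 y1 Dr ry.
  have h2 : q y <= q s by apply: qnd => //; rewrite ?in_itv/= ?y0 ?y1// ltW.
  by rewrite ger0_norm ?subr_ge0//; rewrite -/(q s) in qx; lra.
- pose J := [set s | D' s /\ q s < u s].
  have /choice[rho rhoP] : forall s, exists r : rat, J s -> q s < ratr r < u s.
    move=> s; have [[Ds qu]|nJ] := pselect (J s); last by exists 0 => /nJ.
    by have [r] := rat_in_itvoo qu; rewrite in_itv/= => h; exists r.
  have cJ : countable J.
    apply/countable_injP; exists (pickle \o rho) => s s' sJ s'J /(pcan_inj pickleK) rr.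
    have wlt x y : J x -> J y -> x < y -> rho x = rho y -> False.
      move=> Jx Jy xy rxy; have /andP[_ h1] := rhoP _ Jx; have /andP[h2 _] := rhoP _ Jy.
      have [Dx _] := Jx; have [Dy _] := Jy.
      have /andP[y0 y1] := D'01 _ Dy.
      have := qge y x y0 y1 Dx xy.
      move: h1 h2; rewrite rxy => h1 h2 h3.
      by have := lt_trans h1 (le_lt_trans h3 h2); rewrite ltxx.
    have [lt|lt|//] := ltgtP s s'.
    + by case: (wlt s s') => //; [exact: set_mem sJ|exact: set_mem s'J].
    + by case: (wlt s' s) => //; [exact: set_mem s'J|exact: set_mem sJ].
  apply: (ae_Lambda01_and _ aeD' (Lambda01_countable_negligible cJ)) => s Ds nJ.
  have /andP[s0 s1] := D'01 _ Ds.
  apply/eqP; rewrite eq_le qle// andbT leNgt; apply/negP => qu.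
  exact: nJ.
Qed.

(** The bound extends from a dense set by left continuity at [s1] and
    monotonicity below [s2]. *)
Lemma left_continuous_repr_lower (u : L2 R) D B q : {ae Lam, forall s, D s} ->
  0 <= B -> lower_lipschitz_on D B u -> left_continuous_repr u q ->
  lower_lipschitz_on `]0, 1[%classic B q.
Proof.
move=> aeD B0 uB [qnd qlc uq] s1 s2 s1I s2I.
rewrite le_eqVlt => /predU1P[->|s12]; first by rewrite !subrr mulr0.
have aeDq : {ae Lam, forall s, D s /\ u s = q s}.
  by apply: (ae_Lambda01_and _ aeD uq) => s.
have := s1I; have := s2I; rewrite /= !in_itv/= => /andP[s20 s21] /andP[s10 s11].
apply/ler_addgt0Pr => e e0.
have e2 : 0 < e / 2 by rewrite divr_gt0.
have [d /= d0 Hd] := (cvgrPdist_lt _ _).1 (qlc s1 s1I) _ e2.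
pose eta := Num.min (s2 - s1) (e / (2 * (B + 1))).
have B1 : 0 < 2 * (B + 1) by rewrite mulr_gt0// ltr_wpDl.
have eta0 : 0 < eta by rewrite lt_min subr_gt0 s12 divr_gt0.
have Beta : B * eta <= e / 2.
  have : eta <= e / (2 * (B + 1)) by rewrite ge_min lexx orbT.
  by rewrite ler_pdivlMr// => h; have := ltW eta0; lra.
have etas : eta <= s2 - s1 by rewrite ge_min lexx.
have [r2 [Dr2 ur2] /andP[r2a r2b]] := ae_Lambda01_dense aeDq
  (ltac:(lra) : 0 <= s2 - eta) (ltac:(lra) : s2 - eta < s2) (ltW s21).
have m0 : 0 <= Num.max 0 (s1 - d) by rewrite le_max lexx.
have m1 : Num.max 0 (s1 - d) < s1 by rewrite gt_max s10 gtrBl.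
have [r1 [Dr1 ur1]] := ae_Lambda01_dense aeDq m0 m1 (ltW s11).
rewrite gt_max => /andP[/andP[r10 r1a] r1b].
have h1 : q s1 - e / 2 < q r1.
  have := Hd r1; rewrite /ball/= gtr0_norm ?subr_gt0// => /(_ (ltac:(lra)) r1b).
  by move=> /ltr_normlW; lra.
have h2 : q r2 <= q s2 by apply: qnd => //; rewrite ?in_itv/= ?ltW//; apply/andP; split; lra.
have := uB _ _ Dr1 Dr2 (ltac:(lra)); rewrite ur1 ur2 => h3.
have : B * (s2 - s1 - eta) <= B * (r2 - r1) by rewrite ler_wpM2l//; lra.
lra.
Qed.

Lemma lcreprP (u : L2 R) : (exists q, left_continuous_repr u q) ->
  left_continuous_repr u (lcrepr u).
Proof.
by move=> [q uq]; rewrite /lcrepr; case: xgetP => [q' _ //|/(_ q)].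
Qed.

Lemma Llow_ge q B : {in `]0, 1[ &, {homo q : x y / x <= y}} -> 0 <= B ->
  lower_lipschitz_on `]0, 1[%classic B q -> B <= Llow q.
Proof.
move=> qnd B0 qB; apply: (Llow_max qnd).2; split => // s1 s2 s1I s2I.
rewrite neq_lt => /orP[] s12.
  rewrite -mulrNN -invrN !opprB ler_pdivlMr ?subr_gt0//.
  by apply: qB => //; exact: ltW.
by rewrite ler_pdivlMr ?subr_gt0//; apply: qB => //; exact: ltW.
Qed.

(** The increment is the measure of the levels with values between [x] and [y],
    and these lie within distance [(y - x) / B] of each other. *)
Lemma Rplus_pushforward_le (u : L2 R) D B x y : {ae Lam, forall s, D s} ->
  0 < B -> lower_lipschitz_on D B u -> x <= y ->
  0 <= Rplus (pushforward Lam u) y - Rplus (pushforward Lam u) x <= (y - x) / B.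
Proof.
move=> [N [mN N0 DN]] B0 uB xy.
have mray z : measurable (u @^-1` [set` `]-oo, z]] : set (measurableTypeR R)).
  by rewrite -[X in measurable X]setTI; apply: (L2_measurable u).
pose P := u @^-1` [set` `]-oo, y]] `\` u @^-1` [set` `]-oo, x]].
have mP : measurable (P : set (measurableTypeR R)) by apply: measurableD.
have finL (A : set (measurableTypeR R)) : measurable A -> Lam A \is a fin_num.
  by move=> mA; rewrite ge0_fin_numE// Lambda01_lty.
have -> : Rplus (pushforward Lam u) y - Rplus (pushforward Lam u) x = fine (Lam P).
  rewrite /Rplus /pushforward -fineB ?finL//; congr fine.
  rewrite [RHS](@measureD _ _ _ Lam); [|exact: mray|exact: mray|exact: (Lambda01_lty (mray y))].
  rewrite setIidr// => s /=; rewrite !in_itv/= => /le_trans; exact.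
rewrite fine_ge0//=.
rewrite -lee_fin fineK ?finL//.
pose S := P `&` (~` N).
have PS : P `<=` S `|` N by move=> s Ps; have [Ns|nNs] := pselect (N s); [right|left].
have Sdist s1 s2 : S s1 -> S s2 -> s1 <= s2 -> s2 - s1 <= (y - x) / B.
  move=> [[P1 P1'] N1] [[P2 P2'] N2] s12; rewrite ler_pdivlMr// mulrC.
  have D1 : D s1 by apply: contrapT => nD; exact/N1/DN.
  have D2 : D s2 by apply: contrapT => nD; exact/N2/DN.
  rewrite (le_trans (uB _ _ D1 D2 s12))//.
  move: P1' P2; rewrite /= !in_itv/= => /negP; rewrite -ltNge; lra.
have yx0 : 0 <= (y - x) / B by rewrite divr_ge0 ?subr_ge0// ltW.
have [S0|/set0P[s0 Ss0]] := eqVneq S set0.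
  apply: (@le_trans _ _ (Lam N)); last by rewrite N0 lee_fin.
  by apply: le_measure; rewrite ?inE//; move: PS; rewrite S0 set0U.
have Sbd s : S s -> s0 - (y - x) / B <= s <= s0 + (y - x) / B.
  move=> Ss; have [h|/ltW h] := leP s s0.
    by have := Sdist _ _ Ss Ss0 h; lra.
  by have := Sdist _ _ Ss0 Ss h; lra.
have hsup : has_sup S by split; [exists s0|exists (s0 + (y - x) / B) => s /Sbd /andP[]].
have hinf : has_inf S by split; [exists s0|exists (s0 - (y - x) / B) => s /Sbd /andP[]].
have len : sup S - inf S <= (y - x) / B.
  rewrite lerBlDr; apply: ge_sup; first exact: hsup.1.
  move=> s Ss; rewrite -lerBlDl; apply: lb_le_inf; first exact: hsup.1.
  move=> s' Ss'; have [h|/ltW h] := leP s' s; first by have := Sdist _ _ Ss' Ss h; lra.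
  lra.
have Sitv : S `<=` `[inf S, sup S].
  move=> s Ss /=; rewrite in_itv/=; apply/andP; split.
    exact: (ge_inf hinf.2).
  exact: (ub_le_sup hsup.2).
apply: (@le_trans _ _ (Lam (`[inf S, sup S] `|` N))).
  apply: le_measure; rewrite ?inE//; first exact: measurableU.
  by apply: (subset_trans PS); exact: setSU.
apply: (@le_trans _ _ (Lam `[inf S, sup S]%classic + Lam N)%E).
  exact: measureU2.
rewrite N0 adde0 /Lambda01/= /mrestr.
apply: (@le_trans _ _ (leb `[inf S, sup S]%classic)).
  by apply: le_measure; rewrite ?inE//; exact: measurableI.
rewrite /= lebesgue_measure_itv/= lte_fin.
by case: ifP => // _; rewrite -EFinB lee_fin.
Qed.

End representative.

Section lipschitz_real.
Context {R : realType}.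
Implicit Types (f : R -> R) (k : R).

Lemma lipschitz_of_le f k : (forall x y, `|f y - f x| <= k * `|y - x|) ->
  lipschitz (f : R^o -> R^o).
Proof.
move=> fk; exists k; split; first exact: num_real.
move=> M kM [x y] _ /=.
by rewrite (le_trans (fk _ _))// ler_wpM2r// ltW.
Qed.

Lemma Lip_le f k : (forall x y, `|f y - f x| <= k * `|y - x|) -> (Lip f <= k%:E)%E.
Proof.
move=> fk; apply: ge_ereal_sup => _ [[x y] /= xy <-]; rewrite lee_fin.
by rewrite ler_pdivrMr ?normr_gt0 ?subr_eq0//.
Qed.

End lipschitz_real.

(** * The gradient flow *)

Section flow.
Context {R : realType} (nu mu0 : probability (measurableTypeR R) R).
Local Notation leb := (@lebesgue_measure R).
Local Notation Lam := (@Lambda01 R).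
Local Notation L := (Llow (quantile nu)).
Local Notation b0 := (Llow (quantile mu0)).
Hypothesis nu2 : finite_second_moment nu.
Hypothesis L0 : 0 < L.
Variable g : R -> L2 R.
Hypothesis gP : strong_solution (Ffun nu) (quantile mu0) g.

Lemma strong_solution_velocity : {ae leb, forall t, 0 < t ->
  exists2 d, strong_derivative g t d & norm2 (d - velocity nu (g t)) = 0}.
Proof.
have [_ _ _] := gP; apply: ae_lebesgueW => t H t0.
have [d gd sd] := H t0; exists d => //.
by rewrite norm2B addrC; exact: subdifferential_velocity.
Qed.

(** The bound for Euler polygons passes to an almost everywhere convergent
    subsequence; its constants tend to the stated one. *)
Lemma flow_lower_lipschitz (t : R) : 0 <= t -> exists D : set R,
  {ae Lam, forall s, D s} /\
  lower_lipschitz_on D (Llow_mix nu b0 (expR (- (2 * t / L)))) (g t).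
Proof.
move=> t0; have [gW gC g0 _] := gP.
have L20 : 0 <= 2 / L by rewrite divr_ge0// ltW.
pose V n := euler (velocity nu) (t / n.+1%:R) (g 0) n.+1.
have cV : norm2 (V n - g t) @[n --> \oo] --> (0 : R).
  pose K := 2 / L * 2 * t ^+ 2 * expR (2 / L * t).
  apply: (@squeeze_cvgr _ _ _ _ (cst 0) (fun n => K / n.+1%:R)).
  - near=> n; rewrite norm2_ge0/=.
    exact: (euler_error (ler0n R 2) L20 (velocity_bounded nu)
      (velocity_lipschitz L0) gW gC strong_solution_velocity n t0).
  - exact: cvg_cst.
  - by rewrite -(mulr0 K); apply: cvgM; [exact: cvg_cst|exact: cvg_harmonic].
have [phi [phik aeV]] := norm2_cvg_ae cV.
pose D : set R := fun s => ((s \in `]0, 1[) /\ g 0 s = quantile mu0 s) /\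
  V (phi k) s @[k --> \oo] --> g t s.
exists D; split.
  apply: (ae_Lambda01_and _ (ae_Lambda01_in g0) aeV) => s [gs sI] Vs.
  by split.
have [[b00 _] _] := Llow_max (@quantile_nd _ mu0).
move=> s1 s2 [[s1I gs1] V1] [[s2I gs2] V2] s12.
have cphi : phi k @[k --> \oo] --> \oo.
  move=> A [N _ NA]; exists N => // k Nk; apply: NA.
  exact: (leq_trans Nk (phik k)).
have cr : Llow_mix nu b0 ((1 - 2 * (t / (phi k).+1%:R) / L) ^+ (phi k).+1)
    @[k --> \oo] --> Llow_mix nu b0 (expR (- (2 * t / L))).
  have t2 : 0 <= 2 * t / L by rewrite divr_ge0 ?mulr_ge0// ltW.
  have cr : (1 - 2 * (t / (phi k).+1%:R) / L) ^+ (phi k).+1 @[k --> \oo] -->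
      expR (- (2 * t / L)).
    under eq_cvg do rewrite mulrA mulrAC.
    exact: (cvg_comp _ _ cphi (cvg_exp_compound t2)).
  apply: cvgD; first by apply: cvgM => //; exact: cvg_cst.
  by apply: cvgM; [exact: cvg_cst|apply: cvgB => //; exact: cvg_cst].
have c1 : Llow_mix nu b0 ((1 - 2 * (t / (phi k).+1%:R) / L) ^+ (phi k).+1) * (s2 - s1)
    @[k --> \oo] --> Llow_mix nu b0 (expR (- (2 * t / L))) * (s2 - s1).
  by apply: cvgM; [exact: cr|exact: cvg_cst].
apply: (ler_cvg_to c1 (cvgB V2 V1)).
have hn : (fun k => 2 * t / (k.+1%:R : R)) @ \oo --> (0 : R).
    by rewrite -(mulr0 (2 * t)); apply: cvgM; [exact: cvg_cst|exact: cvg_harmonic].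
  have /cvgrPdist_lt /(_ L L0) [N _ HN] := hn.
  exists N => // k Nk.
  have n0 : 0 < (phi k).+1%:R :> R by rewrite ltr0n.
  apply: euler_lower_lipschitz => //.
  + by rewrite divr_ge0// ltW.
  + have := HN _ (leq_trans Nk (phik k)); rewrite sub0r normrN ger0_norm.
      by rewrite mulrA => /ltW.
    by rewrite divr_ge0 ?mulr_ge0// ltW.
  + rewrite gs1 gs2; move: s12; rewrite le_eqVlt => /predU1P[->|s12].
      by rewrite !subrr mulr0.
    rewrite -ler_pdivlMr ?subr_gt0//.
    by have [[_ H] _] := Llow_max (@quantile_nd _ mu0); apply: H => //; rewrite gt_eqF.
Unshelve. all: end_near. Qed.

End flow.

Unset Implicit Arguments.

Theorem theorem6p5 (R : realType) (nu mu0 : probability (measurableTypeR R) R)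
    (nu2 : finite_second_moment nu) (mu02 : finite_second_moment mu0)
    (Lnu : 0 < Llow (quantile nu))
    (g : R -> L2 R) (gP : strong_solution (Ffun nu) (quantile mu0) g) :
  let B t := Llow (quantile mu0) * expR (- (2 * t / Llow (quantile nu))) +
             Llow (quantile nu) * (1 - expR (- (2 * t / Llow (quantile nu)))) in
  let gamma t := pushforward Lambda01 (g t) in
  [/\ lipschitz (Rplus nu : R^o -> R^o),
      forall t, 0 <= t -> C01 (g t),
      forall t, 0 < t -> Llow (lcrepr (g t)) >= B t /\ B t > 0 &
      forall t, 0 < t ->
        lipschitz (Rplus (gamma t) : R^o -> R^o) /\
        (Lip (Rplus (gamma t)) <= ((B t)^-1)%:E < +oo)%E].
Proof.
move=> B gamma.
have [[b00 _] _] := Llow_max (@quantile_nd _ mu0).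
have Bgt0 t : 0 < t -> 0 < B t.
  move=> t0; rewrite /B ltr_wpDl ?mulr_ge0 ?expR_ge0// mulr_gt0// subr_gt0.
  by rewrite expR_lt1 oppr_lt0 divr_gt0// mulr_gt0.
have Bge0 t : 0 <= t -> 0 <= B t.
  move=> t0; rewrite /B addr_ge0 ?mulr_ge0 ?expR_ge0 ?(ltW Lnu)// subr_ge0.
  by rewrite expR_le1 oppr_le0 divr_ge0 ?mulr_ge0 ?(ltW Lnu).
have low t : 0 <= t -> exists D : set R,
    {ae Lambda01, forall s, D s} /\ lower_lipschitz_on D (B t) (g t).
  exact: flow_lower_lipschitz.
have repr t : 0 <= t -> exists q, left_continuous_repr (g t) q.
  move=> t0; have [D [aeD gD]] := low t t0.
  apply: (left_continuous_repr_exists aeD) => s1 s2 D1 D2 s12.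
  by rewrite -subr_ge0 (le_trans _ (gD _ _ D1 D2 s12))// mulr_ge0 ?Bge0// subr_ge0.
split.
- have lip x y : `|Rplus nu y - Rplus nu x| <= (Llow (quantile nu))^-1 * `|y - x|.
    by rewrite mulrC; exact: Rplus_lipschitz.
  exact: lipschitz_of_le lip.
- by move=> t t0; have [q [qnd _ qg]] := repr t t0; exists q.
- move=> t t0; split; last exact: Bgt0.
  have [D [aeD gD]] := low t (ltW t0).
  have gr := lcreprP (repr t (ltW t0)).
  have [qnd _ _] := gr.
  apply: Llow_ge => //; first exact/Bge0/ltW.
  exact: (left_continuous_repr_lower aeD (Bge0 t (ltW t0)) gD gr).
- move=> t t0; have [D [aeD gD]] := low t (ltW t0).
  have lip x y : `|Rplus (gamma t) y - Rplus (gamma t) x| <= (B t)^-1 * `|y - x|.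
    have H z w : z <= w ->
        `|Rplus (gamma t) w - Rplus (gamma t) z| <= (B t)^-1 * `|w - z|.
      move=> zw; have /andP[h0 h1] := Rplus_pushforward_le aeD (Bgt0 t t0) gD zw.
      by rewrite (ger0_norm h0) (@ger0_norm _ (w - z)) ?subr_ge0// mulrC.
    have [xy|/ltW yx] := leP x y; first exact: H.
    by rewrite distrC (distrC y); exact: H.
  split; first exact: lipschitz_of_le lip.
  by rewrite Lip_le//= ltry.
Qed.
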